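(* Let $0<s<1$, $m>1$, $c\in\mathbb{R}$, $\nu_1\in\mathbb{R}\setminus\{0\}$ and $\nu_2\in\{1,-1\}$. The equation $$-c\phi+\nu_1(-\Delta)^s\phi+\frac{\nu_2}{m}|\phi|^{m-1}\phi=0\qquad\text{on }\mathbb{R}^2$$ cannot have a smooth, non-trivial, vanishing at infinity solution $\phi$ unless one of the following holds: - $\nu_1<0$, $\nu_2=1$, $c>0$, $1<m<\frac{1+s}{1-s}$; - $\nu_1>0$, $\nu_2=-1$, $c<0$, $1<m<\frac{1+s}{1-s}$; - $\nu_1>0$, $\nu_2=-1$, $c>0$, $m>\frac{1+s}{1-s}$; - $\nu_1<0$, $\nu_2=1$, $c<0$, $m>\frac{1+s}{1-s}$; - $c=0$, $\nu_1\nu_2<0$, $m=\frac{1+s}{1-s}$.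
   Context: Functions are real-valued. $(-\Delta)^s$ is the Fourier multiplier operator with symbol $|\xi|^{2s}$ on $\mathbb{R}^2$. ''Smooth, vanishing at infinity'' means that $\phi$ has sufficient regularity and decay: $\phi\in L^2(\mathbb{R}^2)$, all the integrals involved are finite, the equation may be multiplied by $\phi$, $x\phi_x$ and $y\phi_y$ and integrated over $\mathbb{R}^2$, and the resulting integrations by parts (without boundary terms) and uses of Plancherel's theorem are legitimate. *)

(* Defs.v *)
From HB Require Import structures.
From mathcomp Require Import all_boot all_order all_algebra.
From mathcomp Require Import all_classical all_reals all_analysis.
From mathcomp Require Import complex.
Set Implicit Arguments.
Unset Strict Implicit.
Unset Printing Implicit Defensive.
Import Order.TTheory GRing.Theory Num.Theory.
Import numFieldNormedType.Exports.
Local Open Scope classical_set_scope.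
Local Open Scope ring_scope.
Local Open Scope complex_scope.

Section Plane.
Variable R : realType.

Definition leb2 : {measure set (measurableTypeR R * measurableTypeR R) -> \bar R} :=
  ((@lebesgue_measure R) \x (@lebesgue_measure R))%E.

Definition dot2 (p q : R * R) : R := p.1 * q.1 + p.2 * q.2.

Definition L2 (f : R * R -> R) : Prop := f \in Lfun leb2 2%:E.

Definition disc (r : R) : set (R * R) := [set p | dot2 p p <= r ^+ 2].

(* The integral over D of f(p) exp(-i p.xi), split into real and imaginary
   parts; meaningful when f is integrable on D. *)
Definition fourier_on (D : set (R * R)) (f : R * R -> R) (xi : R * R) : R[i] :=
  (\int[leb2]_(p in D) (f p * cos (dot2 p xi)))
  -i* (\int[leb2]_(p in D) (f p * sin (dot2 p xi))).

Definition L2dist (F G : R * R -> R[i]) : \bar R :=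
  let diff xi := (ComplexField.Normc.normc (F xi - G xi))%:E in
  'N[leb2]_2%:E[diff]%E.

(* F is (a representative of) the Fourier-Plancherel transform of the
   square-integrable function f: the limit in L2 of the Fourier integrals
   of f truncated to discs.  With the convention exp(-i p.xi) the symbol of
   -Delta is |xi|^2. *)
Definition is_fourier (f : R * R -> R) (F : R * R -> R[i]) : Prop :=
  [/\ L2 f, L2 (fun xi => complex.Re (F xi)), L2 (fun xi => complex.Im (F xi))
    & L2dist (fourier_on (disc n%:R) f) F @[n --> \oo] --> 0%E].

(* g = (-Delta)^s f as an element of L2, on the natural domain of the
   multiplier; dot2 xi xi `^ s is |xi|^(2s). *)
Definition is_frac_laplacian (s : R) (f g : R * R -> R) : Prop :=
  exists F : R * R -> R[i],
    is_fourier f F /\ is_fourier g (fun xi => (dot2 xi xi `^ s)%:C * F xi).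

Definition dx (f : R * R -> R) (p : R * R) : R := 'D_((1, 0) : R * R) f p.
Definition dy (f : R * R -> R) (p : R * R) : R := 'D_((0, 1) : R * R) f p.

Definition C1 (f : R * R -> R) : Prop :=
  [/\ forall p, derivable f p ((1, 0) : R * R), continuous (dx f),
      forall p, derivable f p ((0, 1) : R * R) & continuous (dy f)].

(* Regularity and decay of phi.  No integration by parts or Plancherel identity
   is assumed.  For a solution (see [solves]) phi, (-Delta)^s phi, x phi_x and
   y phi_y are in L2, hence by the equation so is |phi|^m, and all products that
   arise on multiplying the equation by phi, x phi_x and y phi_y are integrable. *)
Definition smooth_vanishing (phi : R * R -> R) : Prop :=
  [/\ C1 phi, L2 phi, L2 (fun p => p.1 * dx phi p)
    & L2 (fun p => p.2 * dy phi p)].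

(* (-Delta)^s phi is only determined up to a null set, so the equation is
   required almost everywhere. *)
Definition solves (s m c nu1 nu2 : R) (phi : R * R -> R) : Prop :=
  exists g : R * R -> R, is_frac_laplacian s phi g /\
    {ae leb2, forall p,
      - c * phi p + nu1 * g p + nu2 / m * (`|phi p| `^ (m - 1) * phi p) = 0}.

End Plane.

(* Main.v *)
From HB Require Import structures.
Require Import Defs.
From mathcomp Require Import all_boot all_order all_algebra.
From mathcomp Require Import all_classical all_reals all_analysis.
From mathcomp Require Import measurable_realfun complex ring lra.
Set Implicit Arguments.
Unset Strict Implicit.
Unset Printing Implicit Defensive.
Import Order.TTheory GRing.Theory Num.Theory.
Import numFieldNormedType.Exports.
Local Open Scope classical_set_scope.
Local Open Scope ring_scope.

(** The statement follows from two linear relations between the three numbers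
    M = int phi ^ 2, A = int phi (-Delta)^s phi and N = int |phi| ^ (m + 1).
    Testing the equation against phi gives
      - c M + nu1 A + (nu2 / m) N = 0,
    and testing it against the radial derivative w = x phi_x + y phi_y gives
      c M - nu1 (1 - s) A - 2 nu2 / (m (m + 1)) N = 0,
    because the integrals of w times phi, (-Delta)^s phi and |phi| ^ (m - 1) phi
    are - M, (s - 1) A and - 2 / (m + 1) N (lemma [pohozaev]).  As M and N are
    positive and A is nonnegative, the sum of the relations makes nu1 nu2
    negative, and eliminating A determines the sign of c from that of
    (1 + s) - m (1 - s).

    No integration by parts is used for the three integrals against w.  Write
    phi_t for the dilation p |-> phi (t p).  For a square-integrable u, the
    function t |-> int phi_t u has derivative int w u at t = 1
    ([dil_derivative]).  For each of the three choices of u it also lies below an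
    explicit function of t, with equality at t = 1 ([self_bound], [frac_bound],
    [power_bound]); the bounds come from a b <= (a ^ 2 + b ^ 2) / 2 or Young's
    inequality together with the scaling of the integrals.  Two functions of
    which one touches the other from below have the same derivative there
    ([touching]), which yields the three values.

    For [dil_derivative], the difference quotients converge pointwise by the
    chain rule, and their norms are asymptotically at most the norm of w
    ([dil_increment_bound]: write the increment as an integral along the ray,
    then use Jensen's inequality and Tonelli's theorem).  Fatou's lemma turns
    these two facts into weak convergence ([weak_cvg]).

    The bound for u = (-Delta)^s phi is read off on the Fourier side, so that
    Parseval's identity is needed between g = (-Delta)^s phi and phi_t.  It is
    proved for a continuous function against an arbitrary one, both
    square-integrable.  For truncated functions, the frequency integral is damped by
    exp (- e |xi_1| - e |xi_2|), whose transform is a product of Poisson kernels;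
    Fubini's theorem rewrites the damped integral as a convolution
    ([damped_parseval]), and the kernels concentrate as e tends to 0
    ([parseval_L1]).  The truncations are then removed in L2 ([parseval_lim]). *)

(** * Square-integrable real functions *)
Section SquareIntegrable.
Context d (T : measurableType d) (R : realType).
Variable mu : {measure set T -> \bar R}.
Implicit Types f g u v w : T -> R.

Definition intg f := mu.-integrable setT (EFin \o f).
Definition sqint f := measurable_fun setT f /\ intg (fun x => f x ^+ 2).

Lemma intg_meas f : intg f -> measurable_fun setT f.
Proof. by case/integrableP => /measurable_EFinP. Qed.

Lemma eq_intg f g : f =1 g -> intg f -> intg g.
Proof. by move=> fg; rewrite /intg; apply: eq_integrable => // x _ /=; rewrite fg. Qed.

Lemma intgD f g : intg f -> intg g -> intg (fun x => f x + g x).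
Proof. by move=> fi gi; have := integrableD measurableT fi gi. Qed.

Lemma intgB f g : intg f -> intg g -> intg (fun x => f x - g x).
Proof. by move=> fi gi; have := integrableB measurableT fi gi. Qed.

Lemma intgZ a f : intg f -> intg (fun x => a * f x).
Proof. by move=> fi; have := integrableZl measurableT a fi. Qed.

Lemma le_intg f g : measurable_fun setT f -> (forall x, `|f x| <= g x) ->
  intg g -> intg f.
Proof.
move=> mf fg; apply: le_integrable => //; first exact/measurable_EFinP.
by move=> x _ /=; rewrite lee_fin (le_trans (fg x))// ler_norm.
Qed.

Lemma sqint_mul f g : sqint f -> sqint g -> intg (fun x => f x * g x).
Proof.
move=> [mf f2] [mg g2]; apply: (le_intg _ _ (intgD f2 g2)).
  exact: measurable_funM.
move=> x; rewrite normrM -(normr_id (f x)) -(normr_id (g x)).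
rewrite -[f x ^+ 2]real_normK ?num_real// -[g x ^+ 2]real_normK ?num_real//.
move: (normr_ge0 (f x)) (normr_ge0 (g x)).
rewrite !normr_id; move: `|f x| `|g x| => a b; nra.
Qed.

Lemma eq_sqint f g : f =1 g -> sqint f -> sqint g.
Proof. by move=> /funext ->. Qed.

Lemma sqintD f g : sqint f -> sqint g -> sqint (fun x => f x + g x).
Proof.
move=> hf hg; split; first by apply: measurable_funD; [case: hf|case: hg].
have fg := sqint_mul hf hg; case: hf => _ f2; case: hg => _ g2.
apply: eq_intg (intgD (intgD f2 (intgZ 2 fg)) g2) => x /=; ring.
Qed.

Lemma sqintZ a f : sqint f -> sqint (fun x => a * f x).
Proof.
move=> [mf f2]; split; first exact: measurable_funM.
by apply: eq_intg (intgZ (a ^+ 2) f2) => x; rewrite exprMn.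
Qed.

Lemma sqintB f g : sqint f -> sqint g -> sqint (fun x => f x - g x).
Proof.
move=> hf hg; apply: eq_sqint (sqintD hf (sqintZ (-1) hg)) => x.
by rewrite mulN1r.
Qed.

Lemma Lfun2_sqint f : f \in Lfun mu 2%:E -> sqint f.
Proof.
move=> hf; split; first by move: hf; rewrite inE => /andP[]; rewrite inE.
by have := Lfun2_integrable_sqr hf.
Qed.

Lemma Rint_EFin f : intg f -> (\int[mu]_x (f x)%:E = (\int[mu]_x f x)%:E)%E.
Proof. by move=> fi; rewrite fineK//; apply: integrable_fin_num. Qed.

Lemma Cauchy_Schwarz f g : sqint f -> sqint g ->
  (\int[mu]_x (f x * g x)) ^+ 2 <=
  (\int[mu]_x (f x ^+ 2)) * (\int[mu]_x (g x ^+ 2)).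
Proof.
move=> hf hg; have fg := sqint_mul hf hg.
have [_ f2] := hf; have [_ g2] := hg.
set A := \int[mu]_x (f x ^+ 2); set B := \int[mu]_x (g x ^+ 2).
set C := \int[mu]_x (f x * g x).
have key a b : 0 <= a ^+ 2 * A + 2 * a * b * C + b ^+ 2 * B.
  rewrite /A /B /C -!RintegralZl//= -?RintegralD//=; first last.
  - exact: intgZ.
  - exact: intgZ.
  - exact: intgZ.
  - by apply: intgD; apply: intgZ.
  by apply: Rintegral_ge0 => x _; have := sqr_ge0 (a * f x + b * g x); lra.
have A0 : 0 <= A by apply: Rintegral_ge0 => x _; exact: sqr_ge0.
have B0 : 0 <= B by apply: Rintegral_ge0 => x _; exact: sqr_ge0.
have [A1|A1] := eqVneq A 0.
  (* Then B * C ^+ 2 <= 0 and 2 * C ^+ 2 <= B, which forces C = 0. *)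
  have := key B (- C); have := key (- C) 1; rewrite A1.
  by move: A B C A0 B0 {key A1} => A B C A0 B0; nra.
have {}A1 : 0 < A by rewrite lt_neqAle eq_sym A1.
(* The form vanishes at (C, - A) when f and g are proportional. *)
have := key C (- A); rewrite -(ler_pM2l A1).
by move: A B C A0 B0 {key A1} => A B C A0 B0; nra.
Qed.

End SquareIntegrable.

(** * Convergence of integrals of products *)
Section Limits.
Context d (T : measurableType d) (R : realType).
Variable mu : {measure set T -> \bar R}.
Implicit Types f g u v w : T -> R.
Local Notation sqint := (sqint mu).
Local Notation intg := (intg mu).

(** Fatou's lemma as a bound that holds eventually, the form in which it can be
    combined with other eventual bounds. *)
Lemma Fatou_near (q : nat -> T -> R) f :
  (forall n, intg (q n)) -> (forall n x, 0 <= q n x) -> intg f ->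
  (forall x, q n x @[n --> \oo] --> f x) ->
  forall e, 0 < e -> \forall n \near \oo, \int[mu]_x f x - e <= \int[mu]_x q n x.
Proof.
move=> iq q0 fi qf e e0.
have /= := @fatou _ _ _ mu setT measurableT (fun n x => (q n x)%:E).
move=> /(_ (fun n => iffRL (measurable_EFinP _ _) (intg_meas (iq n)))).
move=> /(_ (fun n x _ => q0 n x)).
rewrite [X in (X <= _)%E](_ : _ = (\int[mu]_x f x)%:E)%E; last first.
  rewrite -Rint_EFin//; apply: eq_integral => x _.
  have /cvg_limn_einf_sup[-> //] : (q n x)%:E @[n --> \oo] --> (f x)%:E.
  exact: cvg_comp (qf x) _.
rewrite limn_einf_lim => le1.
have : ((\int[mu]_x f x - e)%:E < ereal_sup (range (einfs (fun n => \int[mu]_x (q n x)%:E))))%E.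
  rewrite (lt_le_trans _ (le_trans le1 _)) ?lte_fin ?ltrBlDr ?ltrDl//.
  by have /cvg_lim -> := @cvg_einfs_sup _ (fun n => \int[mu]_x (q n x)%:E)%E.
move=> /ereal_sup_gt[_ [N _ <-]] lt2.
exists N => // n /= Nn.
rewrite -lee_fin -Rint_EFin//; apply: ltW; apply: (lt_le_trans lt2).
by apply: ereal_inf_lbound; exists n.
Qed.

(** Fatou's lemma for (q n + v) ^ 2 bounds the inner products of q n with v from
    below in the limit, since the norms of q n asymptotically add at most that of
    w.  The same bound for - v gives the other half. *)
Lemma weak_cvg (q : nat -> T -> R) w v (C : nat -> R) :
  (forall n, sqint (q n)) -> sqint w -> sqint v ->
  (forall x, q n x @[n --> \oo] --> w x) ->
  (forall n, \int[mu]_x (q n x ^+ 2) <= C n * \int[mu]_x (w x ^+ 2)) ->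
  C n @[n --> \oo] --> (1 : R) ->
  \int[mu]_x (q n x * v x) @[n --> \oo] --> \int[mu]_x (w x * v x).
Proof.
move=> hq hw hv qw qC C1.
have half u e : sqint u -> 0 < e -> \forall n \near \oo,
    \int[mu]_x (w x * u x) - e <= \int[mu]_x (q n x * u x).
  move=> hu e0.
  have expand g : sqint g -> \int[mu]_x ((g x + u x) ^+ 2) =
      \int[mu]_x (g x ^+ 2) + 2 * \int[mu]_x (g x * u x) + \int[mu]_x (u x ^+ 2).
    move=> hg; have gu := sqint_mul hg hu; have [_ g2] := hg; have [_ u2] := hu.
    rewrite -RintegralZl// -!RintegralD//=; last 2 first.
      by apply: intgD => //; exact: intgZ.
      exact: intgZ.
    by apply: eq_Rintegral => x _; ring.
  have qu n : sqint (fun x => q n x + u x) by exact: sqintD.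
  have wu : sqint (fun x => w x + u x) by exact: sqintD.
  have F : forall e, 0 < e -> \forall n \near \oo,
      \int[mu]_x ((w x + u x) ^+ 2) - e <= \int[mu]_x ((q n x + u x) ^+ 2).
    apply: Fatou_near.
    - by move=> n; case: (qu n).
    - by move=> n x; exact: sqr_ge0.
    - by case: wu.
    - by move=> x; apply: cvgM; apply: cvgD => //; exact: cvg_cst.
  have {F} := F e e0.
  have CW : C n * \int[mu]_x (w x ^+ 2) @[n --> \oo] --> \int[mu]_x (w x ^+ 2).
    rewrite -[X in _ --> X]mul1r; apply: cvgM => //; exact: cvg_cst.
  have /cvgrPdist_le /(_ e e0) := CW.
  apply: filterS2 => n; rewrite expand// expand// ler_norml => /andP[h1 h2] h3.
  have h4 := qC n; lra.
apply/cvgrPdist_le => e e0.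
have := half (fun x => - v x) e _ e0.
move=> /(_ (eq_sqint (fun x => mulN1r _) (sqintZ (-1) hv))).
have := half v e hv e0; apply: filterS2 => n h1.
have opp g : sqint g -> \int[mu]_x (g x * - v x) = - \int[mu]_x (g x * v x).
  move=> hg; rewrite -mulN1r -RintegralZl//; last exact: sqint_mul.
  by apply: eq_Rintegral => x _; ring.
rewrite !opp// => h2; rewrite ler_norml; lra.
Qed.

Definition L2cvg (u : nat -> T -> R) g :=
  [/\ sqint g, \forall n \near \oo, sqint (u n)
    & \int[mu]_x ((u n x - g x) ^+ 2) @[n --> \oo] --> (0 : R)].

(** Only eventual square integrability of the sequences is known for truncated
    Fourier transforms; the error splits into three products, each controlled by
    Cauchy-Schwarz. *)
Lemma L2cvg_mul (F G : nat -> T -> R) f g : L2cvg F f -> L2cvg G g ->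
  \int[mu]_x (F n x * G n x) @[n --> \oo] --> \int[mu]_x (f x * g x).
Proof.
move=> [hf hF Ff] [hg hG Gg].
have sq0 (u : nat -> R) : (u n ^+ 2 @[n --> \oo] --> (0:R)) -> u n @[n --> \oo] --> (0:R).
  move=> u2; apply/norm_cvg0P.
  rewrite -(@sqrtr0 R).
  under eq_fun do rewrite -sqrtr_sqr.
  by apply: (cvg_comp _ _ u2); exact: sqrt_continuous.
have CS (a b : nat -> T -> R) (A B : R) :
    (\forall n \near \oo, sqint (a n)) -> (\forall n \near \oo, sqint (b n)) ->
    \int[mu]_x (a n x ^+ 2) @[n --> \oo] --> A ->
    \int[mu]_x (b n x ^+ 2) @[n --> \oo] --> B -> A * B = 0 ->
    \int[mu]_x (a n x * b n x) @[n --> \oo] --> (0 : R).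
  move=> ha hb aA bB AB; apply: sq0.
  have /= ab := cvgM aA bB; rewrite AB in ab.
  apply: (squeeze_cvgr _ (cvg_cst (0 : R))); last exact: ab.
  near=> n; rewrite sqr_ge0/=.
  by apply: Cauchy_Schwarz; [near: n|near: n].
have dF : \forall n \near \oo, sqint (fun x => F n x - f x).
  by apply: filterS hF => n Fn; exact: sqintB.
have dG : \forall n \near \oo, sqint (fun x => G n x - g x).
  by apply: filterS hG => n Fn; exact: sqintB.
have cf : \forall n \near \oo, sqint ((fun=> f) (n : nat)) by exact: nearW.
have cg : \forall n \near \oo, sqint ((fun=> g) (n : nat)) by exact: nearW.
have c1 : \int[mu]_x ((F n x - f x) * g x) @[n --> \oo] --> (0 : R).
  by apply: (CS _ _ _ _ dF cg Ff _ (mul0r _)); exact: cvg_cst.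
have c2 : \int[mu]_x (f x * (G n x - g x)) @[n --> \oo] --> (0 : R).
  by apply: (CS _ _ _ _ cf dG _ Gg (mulr0 _)); exact: cvg_cst.
have c3 := CS _ _ _ _ dF dG Ff Gg (mulr0 _).
have c4 : (fun=> \int[mu]_x (f x * g x)) (n : nat) @[n --> \oo] -->
    \int[mu]_x (f x * g x) by exact: cvg_cst.
have : \int[mu]_x ((F n x - f x) * g x) + \int[mu]_x (f x * (G n x - g x)) +
    (\int[mu]_x ((F n x - f x) * (G n x - g x)) + \int[mu]_x (f x * g x))
    @[n --> \oo] --> 0 + 0 + (0 + \int[mu]_x (f x * g x)).
  by apply: cvgD; [exact: cvgD|exact: cvgD].
rewrite !add0r; apply: cvg_trans; apply: near_eq_cvg.
near=> n.
have sF : sqint (fun x => F n x - f x) by near: n.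
have sG : sqint (fun x => G n x - g x) by near: n.
rewrite -!RintegralD//=; first by apply: eq_Rintegral => x _; ring.
all: by do ?apply: intgD; exact: sqint_mul.
Unshelve. all: by end_near. Qed.

Lemma L2cvg_sub (u : nat -> T -> R) g (k : nat -> nat) :
  k n @[n --> \oo] --> \oo -> L2cvg u g -> L2cvg (u \o k) g.
Proof.
move=> koo [hg hu ug]; split => //.
  exact: koo hu.
exact: cvg_comp koo ug.
Qed.

(** The term v lets one component of a complex transform be extracted from a
    bound on the squared modulus. *)
Lemma near_L2cvg (u : nat -> T -> R) g (v : nat -> T -> R) :
  sqint g -> (forall n, measurable_fun setT (u n)) ->
  (forall n, measurable_fun setT (v n)) ->
  (forall e, 0 < e -> \forall n \near \oo,
    (\int[mu]_x ((u n x - g x) ^+ 2 + v n x ^+ 2)%:E <= e%:E)%E) ->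
  L2cvg u g.
Proof.
move=> hg mu_ mv small.
have mug n : measurable_fun setT (fun x => u n x - g x).
  by apply: measurable_funB => //; case: hg.
have key e : 0 < e -> \forall n \near \oo,
    sqint (fun x => u n x - g x) /\ \int[mu]_x ((u n x - g x) ^+ 2) <= e.
  move=> e0; apply: filterS (small e e0) => n le.
  have le' : (\int[mu]_x ((u n x - g x) ^+ 2)%:E <= e%:E)%E.
    apply: le_trans le; apply: ge0_le_integral => //.
    - by move=> x _; rewrite lee_fin sqr_ge0.
    - by apply/measurable_EFinP; exact: measurable_funX.
    - apply/measurable_EFinP; apply: measurable_funD; exact: measurable_funX.
    - by move=> x _; rewrite lee_fin lerDl sqr_ge0.
  have i2 : intg (fun x => (u n x - g x) ^+ 2).
    apply/integrableP; split; first by apply/measurable_EFinP; exact: measurable_funX.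
    under eq_integral do rewrite gee0_abs ?lee_fin ?sqr_ge0//.
    by rewrite (le_lt_trans le')// ltry.
  by split => //; rewrite -lee_fin -Rint_EFin.
split => //.
  apply: filterS (key 1 ltr01) => n [un _].
  by apply: eq_sqint (sqintD un hg) => x; rewrite subrK.
apply/cvgrPdist_le => e e0; apply: filterS (key e e0) => n [_ le].
rewrite sub0r normrN ger0_norm//.
by apply: Rintegral_ge0 => x _; exact: sqr_ge0.
Qed.

Lemma Rint_dct (q : nat -> T -> R) f g :
  (forall n, measurable_fun setT (q n)) ->
  (forall x, q n x @[n --> \oo] --> f x) ->
  (forall n x, `|q n x| <= g x) -> intg g ->
  \int[mu]_x q n x @[n --> \oo] --> \int[mu]_x f x.
Proof.
move=> mq qf qg gi.
have mf : measurable_fun setT f by apply: (measurable_fun_cvg mq) => x _; exact: qf.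
have fE x : (q n x)%:E @[n --> \oo] --> (f x)%:E by exact: cvg_comp (qf x) _.
have [|||//||fi _ lim] := @dominated_convergence _ _ _ mu setT measurableT
  (fun n x => (q n x)%:E) (EFin \o f) (EFin \o g).
- by move=> n; exact/measurable_EFinP.
- exact/measurable_EFinP.
- by apply: aeW => x _; exact: fE.
- by apply: aeW => x n _; exact: qg.
have qi n : intg (q n) by exact: le_intg (qg n) gi.
by move: lim; rewrite [X in _ --> X]Rint_EFin// => /fine_cvg.
Qed.

Lemma Rint_eq0_ae f : intg f -> (forall x, 0 <= f x) ->
  \int[mu]_x f x = 0 -> {ae mu, forall x, f x = 0}.
Proof.
move=> fi f0 If.
have : (\int[mu]_x `|(f x)%:E| = 0)%E.
  under eq_integral do rewrite gee0_abs ?lee_fin//.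
  by rewrite Rint_EFin// If.
have mf : measurable_fun setT (EFin \o f) by apply/measurable_EFinP; exact: (intg_meas fi).
move/(ae_eq_integral_abs mu measurableT mf).
by apply: filterS => x /= /(_ I) [].
Qed.

End Limits.

(** * Affine changes of variables in the plane *)
Section AffineChange.
Variable R : realType.
Local Notation leb := (@lebesgue_measure R).
Local Notation plane := (measurableTypeR R * measurableTypeR R)%type.

Lemma measurable_affine (a c : R) :
  measurable_fun setT (fun x : measurableTypeR R => (a + c * x : measurableTypeR R)).
Proof. by apply: measurable_funD => //; exact: measurable_funM. Qed.

Lemma lebesgue_measure_affine (a c : R) (A : set (measurableTypeR R)) : c != 0 ->
  measurable A ->
  (leb A = `|c|%:E * leb ((fun x : measurableTypeR R => a + c * x)%R @^-1` A))%E.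
Proof.
move=> c0 mA; have c0' : 0 <= `|c| by [].
have mf := measurable_affine a c.
pose m := mscale (NngNum c0') (pushforward leb
  (fun x : measurableTypeR R => (a + c * x : measurableTypeR R))).
suff : leb A = m mf A by [].
apply: lebesgue_measure_unique mA => _ [[x y] _ <-].
rewrite -[RHS]/(`|c|%:E *
  leb ((fun x0 : measurableTypeR R => a + c * x0)%R @^-1` `]x, y]%classic))%E.
have Dc z : a + c * ((z - a) / c) = z by field.
have := c0; rewrite neq_lt => /orP[cn|cp].
- rewrite (_ : _ @^-1` _ = `[((y - a) / c), ((x - a) / c)[%classic); last first.
    have Lx z : (x < a + c * z) = (z < (x - a) / c).
      by rewrite -{1}(Dc x) ltrD2l ltr_nM2l.
    have Ly z : (a + c * z <= y) = ((y - a) / c <= z).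
      by rewrite -{1}(Dc y) lerD2l ler_nM2l.
    by apply/seteqP; split => z /=; rewrite !in_itv/= Lx Ly andbC.
  rewrite !lebesgue_measure_itv/= !lte_fin.
  have -> : ((y - a) / c < (x - a) / c) = (x < y).
    by rewrite ltr_nM2r ?invr_lt0// ltrD2r.
  case: ifPn => _; last by rewrite mule0.
  rewrite -!EFinD -EFinM; congr EFin.
  by rewrite ltr0_norm//; field.
- rewrite (_ : _ @^-1` _ = `]((x - a) / c), ((y - a) / c)]%classic); last first.
    have Lx z : (x < a + c * z) = ((x - a) / c < z).
      by rewrite -{1}(Dc x) ltrD2l ltr_pM2l.
    have Ly z : (a + c * z <= y) = (z <= (y - a) / c).
      by rewrite -{1}(Dc y) lerD2l ler_pM2l.
    by apply/seteqP; split => z /=; rewrite !in_itv/= Lx Ly.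
  rewrite !lebesgue_measure_itv/= !lte_fin.
  have -> : ((x - a) / c < (y - a) / c) = (x < y).
    by rewrite ltr_pM2r ?invr_gt0// ltrD2r.
  case: ifPn => _; last by rewrite mule0.
  rewrite -!EFinD -EFinM; congr EFin.
  by rewrite gtr0_norm//; field.
Qed.

Definition affine2 (a : R * R) (c : R) (p : plane) : plane :=
  (a.1 + c * p.1, a.2 + c * p.2).

Lemma measurable_affine2 a c : measurable_fun setT (affine2 a c).
Proof.
apply: measurable_fun_pair.
  by apply: (measurableT_comp (measurable_affine a.1 c)); exact: measurable_fst.
by apply: (measurableT_comp (measurable_affine a.2 c)); exact: measurable_snd.
Qed.

Lemma leb2_affine a c (A : set plane) : c != 0 -> measurable A ->
  (leb2 R A = (c ^+ 2)%:E * leb2 R (affine2 a c @^-1` A))%E.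
Proof.
move=> c0 mA.
have mf := measurable_affine2 a c.
pose m := mscale (NngNum (sqr_ge0 c)) (pushforward (leb2 R) (affine2 a c)).
suff : leb2 R A = m mf A by [].
apply: product_measure_unique mA => B C mB mC.
have mB' : measurable ((fun x : measurableTypeR R => a.1 + c * x)%R @^-1` B).
  by rewrite -[X in measurable X]setTI; exact: (measurable_affine a.1 c).
have mC' : measurable ((fun x : measurableTypeR R => a.2 + c * x)%R @^-1` C).
  by rewrite -[X in measurable X]setTI; exact: (measurable_affine a.2 c).
rewrite /m /mscale /pushforward /=.
rewrite (lebesgue_measure_affine a.1 c0 mB) (lebesgue_measure_affine a.2 c0 mC).
rewrite muleACA -EFinM -expr2 real_normK ?num_real//; congr (_ * _)%E.
by rewrite /leb2 -product_measure1E.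
Qed.

Lemma ge0_integral_affine2 a c (f : plane -> \bar R) : c != 0 ->
  measurable_fun setT f -> (forall p, 0 <= f p)%E ->
  (\int[leb2 R]_p f (affine2 a c p) = (c ^- 2)%:E * \int[leb2 R]_p f p)%E.
Proof.
move=> c0 mf f0.
have mA2 := measurable_affine2 a c.
pose m := mscale (NngNum (sqr_ge0 c)) (pushforward (leb2 R) (affine2 a c)).
have -> : (\int[leb2 R]_p f p = \int[m mA2]_p f p)%E.
  apply: eq_measure_integral => A mA _.
  exact: leb2_affine.
rewrite ge0_integral_mscale//.
rewrite ge0_integral_pushforward//=.
by rewrite muleA -EFinM mulVf ?expf_neq0// mul1e.
Qed.

Lemma intg_affine2 a c (f : plane -> R) : c != 0 -> intg (leb2 R) f ->
  intg (leb2 R) (f \o affine2 a c).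
Proof.
move=> c0 fi; have mf := intg_meas fi; apply/integrableP; split.
  apply/measurable_EFinP; apply: measurableT_comp => //.
  exact: measurable_affine2.
rewrite [ltLHS](_ : _ = (c ^- 2)%:E * \int[leb2 R]_p `|(f p)%:E|)%E.
  case/integrableP : fi => _ fi; rewrite lte_mul_pinfty// lee_fin.
  by rewrite invr_ge0 sqr_ge0.
rewrite -(ge0_integral_affine2 a)//.
by apply/measurable_EFinP; exact: measurableT_comp.
Qed.

Lemma Rint_affine2 a c (f : plane -> R) : c != 0 -> intg (leb2 R) f ->
  \int[leb2 R]_p f (affine2 a c p) = c ^- 2 * \int[leb2 R]_p f p.
Proof.
move=> c0 fi; have mf : measurable_fun setT (EFin \o f).
  by apply/measurable_EFinP; exact: intg_meas fi.
apply: EFin_inj; rewrite EFinM -Rint_EFin//; last exact: (intg_affine2 a c0 fi).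
rewrite -Rint_EFin// -integralZl//.
rewrite integralE [RHS](integralZl measurableT fi) [in RHS]integralE.
rewrite muleBr//; last exact: integrable_add_def.
rewrite -!(ge0_integral_affine2 a)//.
- by congr (_ - _)%E; apply: eq_integral => p _; rewrite unlock.
- exact: measurable_funeneg.
- exact: measurable_funepos.
Qed.

End AffineChange.

(** * Exchanging integrals against a bounded kernel *)
Section BoundedKernel.
Context d1 d2 (X : measurableType d1) (Y : measurableType d2) (R : realType).
Variables (mu : {sigma_finite_measure set X -> \bar R})
  (nu : {sigma_finite_measure set Y -> \bar R}).
Variables (f : X -> R) (a : Y -> R).
Hypotheses (fi : intg mu f) (ai : intg nu a).

Lemma intg_prod : intg (mu \x nu)%E (fun z => f z.1 * a z.2).
Proof.
have mf : measurable_fun setT (fun z : X * Y => f z.1).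
  exact: (measurableT_comp (intg_meas fi) measurable_fst).
have ma : measurable_fun setT (fun z : X * Y => a z.2).
  exact: (measurableT_comp (intg_meas ai) measurable_snd).
apply/integrable12ltyP; first by apply/measurable_EFinP; exact: measurable_funM.
have fn := integrable_norm fi; have an := integrable_norm ai.
rewrite (_ : (\int[mu]_x _)%E =
    \int[mu]_x ((\int[nu]_y `|a y|) * `|f x|)%:E)%E; last first.
  apply: eq_integral => x _.
  under eq_integral do rewrite /= normrM EFinM.
  rewrite ge0_integralZl//=; last first.
    by apply/measurable_EFinP; exact: (intg_meas an).
  by rewrite Rint_EFin// -EFinM mulrC.
by rewrite Rint_EFin ?ltry//; exact: intgZ.
Qed.

Lemma Rint_prod :
  \int[(mu \x nu)%E]_z (f z.1 * a z.2) = (\int[mu]_x f x) * (\int[nu]_y a y).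
Proof.
apply: EFin_inj; rewrite -Rint_EFin; last exact: intg_prod.
rewrite -integral12_prod_meas1; last exact: intg_prod.
have aE x : (\int[nu]_y (f x * a y)%:E = (\int[nu]_y a y)%:E * (f x)%:E)%E.
  by rewrite (Rint_EFin (intgZ (f x) ai)) RintegralZl// mulrC EFinM.
rewrite /fubini_F /=; under eq_integral do rewrite aE.
by rewrite (integralZl measurableT fi) Rint_EFin// -EFinM mulrC.
Qed.

Variable b : X * Y -> R.
Hypotheses (mb : measurable_fun setT b) (b1 : forall z, `|b z| <= 1).

Lemma intg_bdd d (Z : measurableType d) (rho : {measure set Z -> \bar R})
  (u v : Z -> R) : intg rho u -> measurable_fun setT v ->
  (forall z, `|v z| <= 1) -> intg rho (fun z => u z * v z).
Proof.
move=> ui mv v1; apply: (le_intg _ _ (integrable_norm ui)).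
  by apply: measurable_funM => //; exact: intg_meas ui.
by move=> z; rewrite normrM ler_piMr.
Qed.

Let F z := f z.1 * a z.2 * b z.

Let Fi : intg (mu \x nu)%E F.
Proof. by apply: intg_bdd => //; exact: intg_prod. Qed.

Lemma measurable_section1 y : measurable_fun setT (fun x => b (x, y)).
Proof. exact: (measurableT_comp mb (pair2_measurable y)). Qed.

Lemma measurable_section2 x : measurable_fun setT (fun y => b (x, y)).
Proof. exact: (measurableT_comp mb (pair1_measurable x)). Qed.

Let Fx x : intg nu (fun y => F (x, y)).
Proof.
apply: (intg_bdd (intgZ (f x) ai)) => //; exact: measurable_section2.
Qed.

Let Fy y : intg mu (fun x => F (x, y)).
Proof.
apply: (intg_bdd (u := fun x => f x * a y)) => //; last first.
  exact: measurable_section1.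
by apply: eq_intg (intgZ (a y) fi) => x; rewrite mulrC.
Qed.

Let FyE y : \int[mu]_x F (x, y) = a y * \int[mu]_x (f x * b (x, y)).
Proof.
rewrite -RintegralZl//; last by apply: intg_bdd => //; exact: measurable_section1.
by apply: eq_Rintegral => x _; rewrite /F/=; ring.
Qed.

Let FxE x : \int[nu]_y F (x, y) = f x * \int[nu]_y (a y * b (x, y)).
Proof.
rewrite -RintegralZl//; last by apply: intg_bdd => //; exact: measurable_section2.
by apply: eq_Rintegral => y _; rewrite /F/=; ring.
Qed.

(** With f and a integrable and b bounded, f a b is integrable on the product,
    so Fubini applies.  For b the cosine or the sine of the scalar product this is
    the multiplication formula for the Fourier transform. *)
Lemma Fubini_bdd :
  \int[nu]_y (a y * \int[mu]_x (f x * b (x, y))) =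
  \int[mu]_x (f x * \int[nu]_y (a y * b (x, y))).
Proof.
rewrite /Rintegral; congr fine.
have := Fubini Fi => /=.
under eq_integral do rewrite (Rint_EFin (Fx _)) FxE.
by under [in X in _ = X -> _]eq_integral do rewrite (Rint_EFin (Fy _)) FyE.
Qed.

Lemma bdd_kernel2 y : `|\int[mu]_x (f x * b (x, y))| <= \int[mu]_x `|f x|.
Proof.
have fb : intg mu (fun x => f x * b (x, y)).
  by apply: intg_bdd => //; exact: measurable_section1.
apply: (le_trans (le_normr_Rintegral _ _)) => //.
apply: le_Rintegral => //; [exact: integrable_norm|exact: integrable_norm|].
by move=> x _; rewrite normrM ler_piMr.
Qed.

Lemma intg_kernel2 : intg nu (fun y => a y * \int[mu]_x (f x * b (x, y))).
Proof.
apply: (le_intg _ _ (intgZ (\int[mu]_x `|f x|) (integrable_norm ai))).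
  apply/measurable_EFinP; apply: eq_measurable_fun (measurable_fubini_G Fi).
  by move=> y _; rewrite /fubini_G /= (Rint_EFin (Fy _)) FyE.
by move=> y; rewrite normrM mulrC ler_wpM2r// bdd_kernel2.
Qed.

Lemma intg_kernel1 : intg mu (fun x => f x * \int[nu]_y (a y * b (x, y))).
Proof.
apply: eq_integrable (integrable_fubini_F Fi) => // x _.
by rewrite /fubini_F /= (Rint_EFin (Fx _)) FxE.
Qed.

(** Fubini gives the measurability of the transform multiplied by a; a positive a
    can be divided out. *)
Lemma measurable_kernel2 : (forall y, 0 < a y) ->
  measurable_fun setT (fun y => \int[mu]_x (f x * b (x, y))).
Proof.
move=> a0.
have ma : measurable_fun setT (fun y => a y `^ (-1)).
  apply: (@measurableT_comp _ _ _ _ _ _ (fun x : R => x `^ (-1))) => //.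
  exact: intg_meas ai.
apply: eq_measurable_fun (measurable_funM ma (intg_meas intg_kernel2)).
by move=> y _ /=; rewrite powR_inv1 ?ltW// mulrA mulVf ?mul1r ?gt_eqF.
Qed.

End BoundedKernel.

(** * The Poisson kernel as the transform of a decaying exponential *)
Section PoissonKernel.
Variable R : realType.
Local Notation leb := (@lebesgue_measure R).

Definition poisson (e x : R) := 2 * e / (e ^+ 2 + x ^+ 2).

Let E (e t : R) := expR (- e * t).

(** The integrand exp (- e t) (1 + cos (t x)) is nonnegative, unlike the one with
    cos (t x) alone, and so the fundamental theorem on a half-line applies to it
    directly; F is its primitive.  Subtracting the value at x = 0 removes the
    term 1. *)
Let F (e x t : R) := - E e t / e +
  E e t * (x * sin (t * x) - e * cos (t * x)) / (e ^+ 2 + x ^+ 2).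

Let dF (e x t : R) : 0 < e -> is_derive t 1 (F e x) (E e t * (1 + cos (t * x))).
Proof.
move=> e0; have D0 : e ^+ 2 + x ^+ 2 != 0 by nra.
rewrite /F /E; apply: is_derive_eq.
rewrite /GRing.scale/=; field.
by rewrite D0 gt_eqF.
Qed.

Let continuous_E e : continuous (E e).
Proof.
move=> t; apply: continuous_comp; last exact: continuous_expR.
by apply: cvgM; [exact: cvg_cst|exact: cvg_id].
Qed.

Let continuous_Ecos e x : continuous (fun t => E e t * (1 + cos (t * x))).
Proof.
move=> t; apply: cvgM; first exact: continuous_E.
apply: cvgD; first exact: cvg_cst.
apply: continuous_comp; last exact: continuous_cos.
by apply: cvgM; [exact: cvg_id|exact: cvg_cst].
Qed.

Let cvg_E (e : R) : 0 < e -> E e t @[t --> +oo] --> (0 : R).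
Proof.
move=> e0; rewrite /E; under eq_fun do rewrite mulNr.
apply: (@cvg_comp _ _ _ (fun t => e * t) (fun x => expR (- x)) _ (+oo : set_system R)).
  apply/cvgryPge => A; near=> t.
  rewrite mulrC -ler_pdivrMr//; near: t; exact: nbhs_pinfty_ge.
exact: cvgr_expR.
Unshelve. all: by end_near. Qed.

Let cvg_F (e x : R) : 0 < e -> F e x t @[t --> +oo] --> (0 : R).
Proof.
move=> e0; apply/norm_cvg0P.
pose C := e^-1 + (`|x| + e) / (e ^+ 2 + x ^+ 2).
have lim : C * E e t @[t --> +oo] --> (0 : R).
  by rewrite -[X in _ --> X](mulr0 C); apply: cvgM; [exact: cvg_cst|exact: cvg_E].
apply: (squeeze_cvgr _ (cvg_cst (0 : R)) lim).
near=> t; rewrite normr_ge0/=.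
have E0 : 0 < E e t by exact: expR_gt0.
have D0 : 0 < e ^+ 2 + x ^+ 2 by nra.
rewrite /F /C (le_trans (ler_normD _ _))// mulrDl lerD//.
  by rewrite mulNr normrN normrM !gtr0_norm ?invr_gt0// mulrC.
rewrite !normrM (gtr0_norm E0) (gtr0_norm (x := _^-1)) ?invr_gt0//.
rewrite -mulrA [leRHS]mulrC ler_pM2l// ler_pM2r ?invr_gt0//.
rewrite (le_trans (ler_normB _ _))// !normrM (gtr0_norm e0) lerD//.
  by rewrite ler_piMr// sin_max.
by rewrite ler_piMr ?cos_max// ltW.
Unshelve. all: by end_near. Qed.

Let half (e x : R) : 0 < e ->
  (\int[leb]_(t in `[0%R, +oo[) (E e t * (1 + cos (t * x)))%:E =
   (e^-1 + e / (e ^+ 2 + x ^+ 2))%:E)%E.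
Proof.
move=> e0; rewrite (@ge0_continuous_FTC2y _ _ (F e x) _ 0).
- rewrite -EFinB; congr EFin; rewrite /F /E !mulr0 !mul0r expR0 sin0 cos0.
  have D0 : e ^+ 2 + x ^+ 2 != 0 by nra.
  by field; rewrite D0 gt_eqF.
- move=> t _; apply: mulr_ge0; first exact: expR_ge0.
  rewrite -lerBlDl sub0r.
  by have := cos_max (t * x); rewrite ler_norml => /andP[].
- by apply: continuous_subspaceT; exact: continuous_Ecos.
- exact: cvg_F.
- by move=> t _; have [] := dF x t e0.
- apply: cvg_at_right_filter; apply: differentiable_continuous.
  by apply/derivable1_diffP; have [] := dF x 0 e0.
- by move=> t _; rewrite derive1E; have [_ ->] := dF x t e0.
Qed.

Let full (e x : R) : 0 < e ->
  (\int[leb]_t (expR (- e * `|t|) * (1 + cos (t * x)))%:E =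
   (2 * (e^-1 + e / (e ^+ 2 + x ^+ 2)))%:E)%E.
Proof.
move=> e0; rewrite ge0_symfun_integralT; last 3 first.
- move=> t; apply: mulr_ge0; first exact: expR_ge0.
  rewrite -lerBlDl sub0r.
  by have := cos_max (t * x); rewrite ler_norml => /andP[].
- move=> t; apply: cvgM.
    have cE : continuous (E e \o (fun t : R => `|t|)).
      move=> u; apply: continuous_comp; last exact: continuous_E.
      exact: norm_continuous.
    exact: cE.
  apply: cvgD; first exact: cvg_cst.
  apply: continuous_comp; last exact: continuous_cos.
  by apply: cvgM; [exact: cvg_id|exact: cvg_cst].
- by move=> t /=; rewrite normrN (mulNr t x) cosN.
rewrite EFinM -(half x e0); congr (_ * _)%E.
rewrite (_ : [set x | 0 <= x] = `[0%R, +oo[%classic); last first.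
  by apply/seteqP; split => t /=; rewrite in_itv/= andbT.
apply: eq_integral => t; rewrite inE/= in_itv/= andbT => t0.
by rewrite ger0_norm.
Qed.

Lemma measurable_expNabs (e : R) :
  measurable_fun setT (fun t : measurableTypeR R => expR (- e * `|t|)).
Proof.
apply: measurableT_comp => //; apply: measurable_funM => //.
Qed.

Lemma intg_expNabs (e : R) : 0 < e -> intg leb (fun t => expR (- e * `|t|)).
Proof.
move=> e0; have := full 0 e0.
under eq_integral do rewrite mulr0 cos0.
move=> H; apply: (@le_intg _ _ _ leb _ (fun t => expR (- e * `|t|) * (1 + 1))).
- exact: measurable_expNabs.
- by move=> t; rewrite ger0_norm ?expR_ge0// ler_peMr ?expR_ge0//; lra.
- apply/integrableP; split.
    apply/measurable_EFinP; apply: measurable_funM => //.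
    exact: measurable_expNabs.
  under eq_integral do rewrite gee0_abs ?lee_fin ?mulr_ge0 ?expR_ge0//.
  by rewrite [ltLHS]H ltry.
Qed.

Let measurable_trig (g : R -> R) x :
  measurable_fun setT (g : measurableTypeR R -> measurableTypeR R) ->
  measurable_fun setT (fun t : measurableTypeR R => g (t * x)).
Proof. by move=> mg; apply: measurableT_comp => //; exact: measurable_funM. Qed.

Lemma measurable_cosR : measurable_fun setT (@cos R : measurableTypeR R -> R).
Proof. by apply: continuous_measurable_fun; exact: continuous_cos. Qed.

Lemma measurable_sinR : measurable_fun setT (@sin R : measurableTypeR R -> R).
Proof. by apply: continuous_measurable_fun; exact: continuous_sin. Qed.

Lemma intg_expNabs_cos (e x : R) : 0 < e ->
  intg leb (fun t => expR (- e * `|t|) * cos (t * x)).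
Proof.
move=> e0; apply: intg_bdd; first exact: intg_expNabs.
  exact: measurable_trig measurable_cosR.
by move=> t; exact: cos_max.
Qed.

Lemma intg_expNabs_sin (e x : R) : 0 < e ->
  intg leb (fun t => expR (- e * `|t|) * sin (t * x)).
Proof.
move=> e0; apply: intg_bdd; first exact: intg_expNabs.
  exact: measurable_trig measurable_sinR.
by move=> t; exact: sin_max.
Qed.

Let Rfull (e x : R) : 0 < e -> \int[leb]_t (expR (- e * `|t|)) +
    \int[leb]_t (expR (- e * `|t|) * cos (t * x)) =
    2 * (e^-1 + e / (e ^+ 2 + x ^+ 2)).
Proof.
move=> e0; rewrite -RintegralD//=; [|exact: intg_expNabs|exact: intg_expNabs_cos].
rewrite /Rintegral -[RHS]/(fine (2 * (e^-1 + e / (e ^+ 2 + x ^+ 2)))%:E) -full//.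
by congr fine; apply: eq_integral => t _; rewrite mulrDr mulr1.
Qed.

Lemma Rint_expNabs_cos (e x : R) : 0 < e ->
  \int[leb]_t (expR (- e * `|t|) * cos (t * x)) = poisson e x.
Proof.
move=> e0; rewrite /poisson; have := Rfull x e0; have := Rfull 0 e0.
under [X in _ + X = _ -> _]eq_Rintegral do rewrite mulr0 cos0 mulr1.
set I := \int[leb]_t (expR (- e * `|t|)).
have -> : e / (e ^+ 2 + 0 ^+ 2) = e^-1 by field; rewrite gt_eqF.
move=> h1 h2; lra.
Qed.

Lemma Rint_expNabs_sin (e x : R) : 0 < e ->
  \int[leb]_t (expR (- e * `|t|) * sin (t * x)) = 0.
Proof.
move=> e0; set f := fun t => expR (- e * `|t|) * sin (t * x).
have fi : intg leb f by exact: intg_expNabs_sin.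
have mN : measurable_fun setT (-%R : measurableTypeR R -> measurableTypeR R) by [].
have fN : f \o -%R = fun t => -1 * f t.
  by apply/funext => t; rewrite /f /= normrN (mulNr t x) sinN mulN1r mulrN.
have fNi : leb.-integrable setT ((EFin \o f) \o (-%R : measurableTypeR R -> measurableTypeR R)).
  by rewrite -compA fN; exact: intgZ.
have : \int[leb]_t f t = - \int[leb]_t f t.
  rewrite -[RHS]mulN1r -RintegralZl//.
  rewrite {1}/Rintegral (@eq_measure_integral _ _ _ _
    (pushforward leb (-%R : measurableTypeR R -> measurableTypeR R))); last first.
    by move=> A mA _; apply/esym/lebesgue_measureN.
  rewrite integral_pushforward//; last by apply/measurable_EFinP; exact: intg_meas fi.
  rewrite preimage_setT /Rintegral; congr fine; apply: eq_integral => t _ /=.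
  by rewrite -/((f \o -%R) t) fN.
lra.
Qed.

End PoissonKernel.

(** * Parseval's identity with a damping factor *)
Section PlaneSigmaFinite.
Variable R : realType.
Local Notation plane := (measurableTypeR R * measurableTypeR R)%type.

(** A copy of [leb2] that carries its sigma-finiteness, so that Fubini applies
    with the plane as each of the two factors. *)
Definition plane_measure : set plane -> \bar R := leb2 R.
HB.instance Definition _ := Measure.copy plane_measure (leb2 R).

Let plane_sigma_finite : sigma_finite setT plane_measure.
Proof.
have /sigma_finiteP[F [TF ndF Foo]] := sigma_finiteT (@lebesgue_measure R).
exists (fun n => F n `*` F n).
  rewrite -setXTT {1}TF TF predeqE => -[x y]; split.
    move=> [/= [n _ Fnx] [k _ Gky]]; exists (maxn n k) => //; split.
    - by move: x Fnx; exact/subsetPset/ndF/leq_maxl.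
    - by move: y Gky; exact/subsetPset/ndF/leq_maxr.
  by move=> [n _ []/= ? ?]; split; exists n.
move=> k; have [mk fk] := Foo k; split; first exact: measurableX.
rewrite /plane_measure /leb2 [ltLHS]product_measure1E// lte_mul_pinfty//.
by rewrite ge0_fin_numE.
Qed.

HB.instance Definition _ := Measure_isSigmaFinite.Build _ plane R plane_measure
  plane_sigma_finite.

Definition sleb2 : {sigma_finite_measure set plane -> \bar R} := plane_measure.

Section PlaneKernels.
Local Notation mu := (leb2 R).
Variables (f a : R * R -> R) (b : plane * plane -> R).
Hypotheses (fi : intg mu f) (ai : intg mu a).
Hypotheses (mb : measurable_fun setT b) (b1 : forall z, `|b z| <= 1).

Lemma plane_Fubini :
  \int[mu]_y (a y * \int[mu]_x (f x * b (x, y))) =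
  \int[mu]_x (f x * \int[mu]_y (a y * b (x, y))).
Proof. exact: (@Fubini_bdd _ _ _ _ _ sleb2 sleb2). Qed.

Lemma plane_kernel2 : intg mu (fun y => a y * \int[mu]_x (f x * b (x, y))).
Proof. exact: (@intg_kernel2 _ _ _ _ _ sleb2 sleb2). Qed.

Lemma plane_kernel1 : intg mu (fun x => f x * \int[mu]_y (a y * b (x, y))).
Proof. exact: (@intg_kernel1 _ _ _ _ _ sleb2 sleb2). Qed.

Lemma measurable_plane_kernel2 : (forall y, 0 < a y) ->
  measurable_fun setT (fun y => \int[mu]_x (f x * b (x, y))).
Proof. exact: (@measurable_kernel2 _ _ _ _ _ sleb2 sleb2). Qed.
End PlaneKernels.
End PlaneSigmaFinite.

Section TruncatedParseval.
Variable R : realType.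
Local Notation leb := (@lebesgue_measure R).
Local Notation mu := (leb2 R).
Local Notation plane := (measurableTypeR R * measurableTypeR R)%type.
Implicit Types (f h : R * R -> R) (p q xi : R * R) (e : R).

(** The Fourier transform of a real function, as the pair of its cosine and sine
    transforms: the real part and the opposite of the imaginary part. *)
Definition Fcos f xi := \int[mu]_p (f p * cos (dot2 p xi)).
Definition Fsin f xi := \int[mu]_p (f p * sin (dot2 p xi)).

Definition damping e xi := expR (- e * `|xi.1|) * expR (- e * `|xi.2|).
Definition poisson2 e p := poisson e p.1 * poisson e p.2.

Lemma damping_gt0 e xi : 0 < damping e xi.
Proof. by rewrite mulr_gt0 ?expR_gt0. Qed.

Lemma damping_le1 e xi : 0 < e -> damping e xi <= 1.
Proof.
move=> e0; rewrite mulr_ile1 ?expR_ge0// -expR0 ler_expR.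
  by rewrite mulNr oppr_le0 mulr_ge0// ltW.
by rewrite mulNr oppr_le0 mulr_ge0// ltW.
Qed.

Lemma intg_damping e : 0 < e -> intg mu (damping e).
Proof. by move=> e0; exact: (intg_prod (intg_expNabs e0) (intg_expNabs e0)). Qed.

Lemma measurable_dot2 : measurable_fun setT (fun z : plane * plane => dot2 z.1 z.2).
Proof.
have m1 : measurable_fun setT (fst : plane * plane -> plane) by exact: measurable_fst.
have m2 : measurable_fun setT (snd : plane * plane -> plane) by exact: measurable_snd.
have f1 : measurable_fun setT (fst : plane -> measurableTypeR R) by exact: measurable_fst.
have f2 : measurable_fun setT (snd : plane -> measurableTypeR R) by exact: measurable_snd.
apply: measurable_funD; apply: measurable_funM.
- exact: (measurableT_comp f1 m1).
- exact: (measurableT_comp f1 m2).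
- exact: (measurableT_comp f2 m1).
- exact: (measurableT_comp f2 m2).
Qed.

Lemma measurable_cos_dot2 :
  measurable_fun setT (fun z : plane * plane => cos (dot2 z.1 z.2)).
Proof.
by apply: (measurableT_comp (f := @cos R)); [exact: measurable_cosR|exact: measurable_dot2].
Qed.

Lemma measurable_sin_dot2 :
  measurable_fun setT (fun z : plane * plane => sin (dot2 z.1 z.2)).
Proof.
by apply: (measurableT_comp (f := @sin R)); [exact: measurable_sinR|exact: measurable_dot2].
Qed.

Lemma damping_transform e p : 0 < e ->
  \int[mu]_xi (damping e xi * cos (dot2 p xi)) = poisson2 e p.
Proof.
move=> e0; set c := fun x t => expR (- e * `|t|) * cos (t * x).
set s := fun x t => expR (- e * `|t|) * sin (t * x).
have ic x : intg leb (c x) by exact: intg_expNabs_cos.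
have iS x : intg leb (s x) by exact: intg_expNabs_sin.
transitivity (\int[mu]_xi (c p.1 xi.1 * c p.2 xi.2 - s p.1 xi.1 * s p.2 xi.2)).
  apply: eq_Rintegral => xi _; rewrite /damping /dot2 cosD /c /s.
  by rewrite (mulrC p.1) (mulrC p.2); ring.
rewrite RintegralB//; [|exact: (intg_prod (ic _) (ic _))|exact: (intg_prod (iS _) (iS _))].
rewrite (Rint_prod (ic _) (ic _)) (Rint_prod (iS _) (iS _)) /c /s
  !Rint_expNabs_cos// !Rint_expNabs_sin//.
by rewrite mulr0 subr0.
Qed.

(** The cosine and the sine parts take two exchanges of integrals each.  The first
    moves the transform from f onto the damped transform of h; the second moves it
    from h onto the damping factor, which turns into a Poisson kernel because
    cos (p . xi) cos (q . xi) + sin (p . xi) sin (q . xi) = cos ((p - q) . xi). *)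
Lemma damped_parseval e f h : 0 < e -> intg mu f -> intg mu h ->
  \int[mu]_xi (damping e xi * (Fcos f xi * Fcos h xi + Fsin f xi * Fsin h xi)) =
  \int[mu]_p (f p * \int[mu]_q (h q * poisson2 e (p.1 - q.1, p.2 - q.2))).
Proof.
move=> e0 fi hi.
have ki := intg_damping e0.
have c1 (z : plane * plane) : `|cos (dot2 z.1 z.2)| <= 1 by exact: cos_max.
have s1 (z : plane * plane) : `|sin (dot2 z.1 z.2)| <= 1 by exact: sin_max.
have mc := measurable_cos_dot2; have ms := measurable_sin_dot2.
have kc : intg mu (fun xi => damping e xi * Fcos h xi).
  exact: (plane_kernel2 hi ki mc c1).
have ks : intg mu (fun xi => damping e xi * Fsin h xi).
  exact: (plane_kernel2 hi ki ms s1).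
pose kcos p xi := damping e xi * cos (dot2 p xi).
pose ksin p xi := damping e xi * sin (dot2 p xi).
have kcosi p : intg mu (kcos p).
  by apply: intg_bdd => //; [exact: (measurable_section2 mc)|move=> xi; exact: cos_max].
have ksini p : intg mu (ksin p).
  by apply: intg_bdd => //; [exact: (measurable_section2 ms)|move=> xi; exact: sin_max].
have kcosE p : \int[mu]_xi (damping e xi * Fcos h xi * cos (dot2 p xi)) =
    \int[mu]_q (h q * \int[mu]_xi (kcos p xi * cos (dot2 q xi))).
  rewrite -(plane_Fubini hi (kcosi p) mc c1).
  by apply: eq_Rintegral => xi _; rewrite /kcos /Fcos/=; ring.
have ksinE p : \int[mu]_xi (damping e xi * Fsin h xi * sin (dot2 p xi)) =
    \int[mu]_q (h q * \int[mu]_xi (ksin p xi * sin (dot2 q xi))).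
  rewrite -(plane_Fubini hi (ksini p) ms s1).
  by apply: eq_Rintegral => xi _; rewrite /ksin /Fsin/=; ring.
have fc := plane_kernel2 fi kc mc c1; have fs := plane_kernel2 fi ks ms s1.
transitivity (\int[mu]_xi (damping e xi * Fcos h xi * Fcos f xi) +
    \int[mu]_xi (damping e xi * Fsin h xi * Fsin f xi)).
  rewrite -RintegralD//; apply: eq_Rintegral => xi _ /=; ring.
rewrite (plane_Fubini fi kc mc c1) (plane_Fubini fi ks ms s1).
rewrite -RintegralD//; last 2 first.
- exact: (plane_kernel1 fi kc mc c1).
- exact: (plane_kernel1 fi ks ms s1).
apply: eq_Rintegral => p _ /=; rewrite -mulrDr; congr (_ * _).
rewrite kcosE ksinE -RintegralD//; last 2 first.
- exact: (plane_kernel1 hi (kcosi p) mc c1).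
- exact: (plane_kernel1 hi (ksini p) ms s1).
apply: eq_Rintegral => q _ /=; rewrite -mulrDr; congr (_ * _).
rewrite -RintegralD//; last 2 first.
- by apply: intg_bdd => //; [exact: (measurable_section2 mc)|move=> xi; exact: cos_max].
- by apply: intg_bdd => //; [exact: (measurable_section2 ms)|move=> xi; exact: sin_max].
rewrite -damping_transform//; apply: eq_Rintegral => xi _.
have -> : dot2 (p.1 - q.1, p.2 - q.2) xi = dot2 p xi - dot2 q xi.
  by rewrite /dot2/=; ring.
by rewrite cosB /kcos /ksin; ring.
Qed.
End TruncatedParseval.

(** * Removing the damping *)
Section Parseval.
Variable R : realType.
Local Notation leb := (@lebesgue_measure R).
Local Notation mu := (leb2 R).
Local Notation plane := (measurableTypeR R * measurableTypeR R)%type.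
Implicit Types (f h : R * R -> R) (p q xi : R * R) (e x : R).

Lemma poisson_ge0 e x : 0 < e -> 0 <= poisson e x.
Proof. by move=> e0; rewrite /poisson divr_ge0// ?mulr_ge0 ?addr_ge0 ?sqr_ge0// ltW. Qed.

Lemma poisson_le e x : 0 < e -> poisson e x <= 2 / e.
Proof.
move=> e0; rewrite /poisson ler_pdivrMr; last by nra.
have -> : 2 / e * (e ^+ 2 + x ^+ 2) = 2 * e + 2 * x ^+ 2 / e.
  by field; rewrite gt_eqF.
by rewrite lerDl divr_ge0 ?(ltW e0)// mulr_ge0 ?sqr_ge0.
Qed.

Lemma continuous_poisson e : 0 < e -> continuous (poisson e).
Proof.
move=> e0 x; apply: cvgM; first exact: cvg_cst.
apply: cvgV; first by nra.
apply: cvgD; first exact: cvg_cst.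
by apply: cvgM; exact: cvg_id.
Qed.

Lemma measurable_poisson e : 0 < e -> measurable_fun setT (poisson e : measurableTypeR R -> R).
Proof. by move=> e0; apply: continuous_measurable_fun; exact: continuous_poisson. Qed.

Lemma poisson_scale e x : 0 < e -> poisson e (e * x) = e^-1 * poisson 1 x.
Proof.
move=> e0; rewrite /poisson; field.
by rewrite !gt_eqF//=; nra.
Qed.

Let full : (\int[leb]_x (poisson 1 x)%:E = (2 * pi)%:E)%E.
Proof.
rewrite ge0_symfun_integralT; last 3 first.
- by move=> x; exact: poisson_ge0.
- exact: continuous_poisson.
- by move=> x; rewrite /poisson /= sqrrN.
rewrite (_ : [set x | 0 <= x] = `[0%R, +oo[%classic); last first.
  by apply/seteqP; split => t /=; rewrite in_itv/= andbT.
have -> : (2 * pi)%:E = (2 * (2 * (pi / 2)%:E))%E :> \bar R.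
  by rewrite -!EFinM; congr EFin; field.
congr (_ * _)%E.
rewrite -(integral0y_oneDsqr R) -ge0_integralZl//=.
- by apply: eq_integral => x _; rewrite -EFinM /poisson mulr1 expr1n.
- apply/measurable_EFinP; apply: measurable_funTS.
  by apply: continuous_measurable_fun; exact: continuous_oneDsqrV.
Qed.

Lemma intg_poisson1 : intg leb (poisson 1).
Proof.
apply/integrableP; split.
  by apply/measurable_EFinP; exact: measurable_poisson.
under eq_integral do rewrite gee0_abs ?lee_fin ?poisson_ge0//.
by rewrite [ltLHS]full ltry.
Qed.

Lemma Rint_poisson1 : \int[leb]_x poisson 1 x = 2 * pi.
Proof. by rewrite /Rintegral full. Qed.

Lemma intg_poisson2 : intg mu (poisson2 (1 : R)).
Proof. exact: (intg_prod intg_poisson1 intg_poisson1). Qed.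

Lemma Rint_poisson2 : \int[mu]_p poisson2 (1 : R) p = (2 * pi) ^+ 2.
Proof. by rewrite (Rint_prod intg_poisson1 intg_poisson1) Rint_poisson1 expr2. Qed.

Lemma poisson2_ge0 e p : 0 < e -> 0 <= poisson2 e p.
Proof. by move=> e0; rewrite mulr_ge0 ?poisson_ge0. Qed.

Lemma measurable_poisson2 e : 0 < e -> measurable_fun setT (poisson2 e : plane -> R).
Proof.
move=> e0; apply: measurable_funM.
  by apply: (measurableT_comp (measurable_poisson e0)); exact: measurable_fst.
by apply: (measurableT_comp (measurable_poisson e0)); exact: measurable_snd.
Qed.

(** The substitution q = p - e z moves the scale e from the kernel to h, where
    continuity can absorb it. *)
Lemma poisson_convolution e h p : 0 < e -> intg mu h ->
  \int[mu]_q (h q * poisson2 e (p.1 - q.1, p.2 - q.2)) =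
  \int[mu]_z (h (affine2 p (- e) z) * poisson2 1 z).
Proof.
move=> e0 hi; have e0' : - e != 0 by rewrite oppr_eq0 gt_eqF.
have pE q : (p.1 - q.1, p.2 - q.2) = affine2 p (-1) q.
  by rewrite /affine2 !mulN1r.
have gi : intg mu (fun q => h q * poisson2 e (p.1 - q.1, p.2 - q.2)).
  apply: (le_intg _ _ (intgZ ((2 / e) ^+ 2) (integrable_norm hi))).
    apply: measurable_funM; first exact: intg_meas hi.
    under eq_fun do rewrite pE.
    apply: measurableT_comp (measurable_poisson2 e0) _.
    exact: measurable_affine2.
  move=> q; rewrite normrM mulrC ler_wpM2r// ger0_norm ?poisson2_ge0//.
  by rewrite expr2 ler_pM ?poisson_ge0 ?poisson_le.
have := Rint_affine2 p e0' gi; rewrite sqrrN => H.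
have -> : \int[mu]_q (h q * poisson2 e (p.1 - q.1, p.2 - q.2)) =
    e ^+ 2 * (e ^- 2 * \int[mu]_q (h q * poisson2 e (p.1 - q.1, p.2 - q.2))).
  by rewrite mulrA mulfV ?mul1r// expf_neq0// gt_eqF.
rewrite -H -RintegralZl//; last exact: (intg_affine2 p e0' gi).
apply: eq_Rintegral => z _; rewrite mulrCA; congr (_ * _).
rewrite /poisson2 /affine2 /=.
have s x y : x - (x + - e * y) = e * y by ring.
by rewrite !s !poisson_scale//; field; rewrite gt_eqF.
Qed.

Let eps (n : nat) : R := n.+1%:R^-1.

Let eps_gt0 n : 0 < eps n. Proof. by rewrite invr_gt0 ltr0n. Qed.

Let eps0 : eps n @[n --> \oo] --> (0 : R).
Proof. exact: cvg_harmonic. Qed.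

Let cvg_affine2 p z : affine2 p (- eps n) z @[n --> \oo] --> p.
Proof.
have c (x y : R) : x + - eps n * y @[n --> \oo] --> x.
  have : x + - eps n * y @[n --> \oo] --> x + - 0 * y.
    apply: cvgD; first exact: cvg_cst.
    apply: cvgM; last exact: cvg_cst.
    exact: cvgN eps0.
  by rewrite oppr0 mul0r addr0.
case: p => p1 p2; exact: (cvg_pair (c p1 z.1) (c p2 z.2)).
Qed.

Let cvg_convolution h (M : R) p : intg mu h -> (forall q, `|h q| <= M) ->
  {for p, continuous h} ->
  \int[mu]_z (h (affine2 p (- eps n) z) * poisson2 1 z) @[n --> \oo] -->
  (2 * pi) ^+ 2 * h p.
Proof.
move=> hi hM ch.
rewrite -Rint_poisson2 mulrC -RintegralZl//; last exact: intg_poisson2.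
apply: (@Rint_dct _ _ _ mu _ _ (fun z => M * poisson2 1 z)).
- move=> n; apply: measurable_funM; last exact: measurable_poisson2.
  apply: measurableT_comp (intg_meas hi) _; exact: measurable_affine2.
- move=> z; apply: cvgM; last exact: cvg_cst.
  exact: (cvg_comp _ _ (@cvg_affine2 p z) ch).
- move=> n z; rewrite normrM (ger0_norm (poisson2_ge0 _ _))//.
  by rewrite ler_wpM2r ?poisson2_ge0.
- exact: (intgZ M intg_poisson2).
Qed.

(** Follows from Fubini for the kernel, divided by its maximum to be at most 1. *)
Let measurable_convolution e h : 0 < e -> intg mu h ->
  measurable_fun setT
    (fun p => \int[mu]_q (h q * poisson2 e (p.1 - q.1, p.2 - q.2))).
Proof.
move=> e0 hi; pose c := (2 / e) ^+ 2.
have c0 : 0 < c by rewrite exprn_gt0// divr_gt0.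
pose b (z : plane * plane) := c^-1 * poisson2 e (z.2.1 - z.1.1, z.2.2 - z.1.2).
have b1 z : `|b z| <= 1.
  rewrite ger0_norm; last by rewrite mulr_ge0 ?poisson2_ge0// invr_ge0 ltW.
  rewrite /b mulrC ler_pdivrMr// mul1r /c expr2.
  by rewrite ler_pM ?poisson_ge0 ?poisson_le.
have mb : measurable_fun setT b.
  apply: measurable_funM => //; apply: measurableT_comp (measurable_poisson2 e0) _.
  have m1 : measurable_fun setT (fst : plane * plane -> plane) by exact: measurable_fst.
  have m2 : measurable_fun setT (snd : plane * plane -> plane) by exact: measurable_snd.
  have f1 : measurable_fun setT (fst : plane -> measurableTypeR R) by exact: measurable_fst.
  have f2 : measurable_fun setT (snd : plane -> measurableTypeR R) by exact: measurable_snd.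
  apply: measurable_fun_pair; apply: measurable_funB.
  - exact: (measurableT_comp f1 m2).
  - exact: (measurableT_comp f1 m1).
  - exact: (measurableT_comp f2 m2).
  - exact: (measurableT_comp f2 m1).
have mK := measurable_plane_kernel2 hi (intg_damping ltr01) mb b1
  (fun y => damping_gt0 1 y).
apply: eq_measurable_fun (measurable_funM (@measurable_cst _ _ _ _ setT c) mK).
move=> p _ /=; rewrite -RintegralZl//; last first.
  by apply: intg_bdd => //; exact: (measurable_section1 mb).
apply: eq_Rintegral => q _; rewrite mulrCA; congr (_ * _).
by rewrite /b/= mulrA mulfV ?mul1r// gt_eqF.
Qed.

(** Continuity of h is only required where f does not vanish.  This lets h be a
    continuous function cut off outside a disc that contains the support of f in
    its interior. *)
Lemma parseval_L1 f h (M : R) : intg mu f -> intg mu h -> (forall q, `|h q| <= M) ->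
  (forall p, f p != 0 -> {for p, continuous h}) ->
  intg mu (fun xi => Fcos f xi * Fcos h xi + Fsin f xi * Fsin h xi) ->
  \int[mu]_xi (Fcos f xi * Fcos h xi + Fsin f xi * Fsin h xi) =
  (2 * pi) ^+ 2 * \int[mu]_p (f p * h p).
Proof.
move=> fi hi hM ch FI.
set I := fun xi => _.
have lim1 : \int[mu]_xi (damping (eps n) xi * I xi) @[n --> \oo] --> \int[mu]_xi I xi.
  apply: (@Rint_dct _ _ _ mu _ _ (fun xi => `|I xi|)).
  - move=> n; apply: measurable_funM; last exact: intg_meas FI.
    exact: intg_meas (intg_damping (eps_gt0 n)).
  - move=> xi; rewrite -[X in _ --> X]mul1r; apply: cvgM; last exact: cvg_cst.
    have c (x : R) : expR (- eps n * `|x|) @[n --> \oo] --> (1 : R).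
      rewrite -expR0; apply: continuous_cvg; first exact: continuous_expR.
      have : - eps n * `|x| @[n --> \oo] --> - 0 * `|x|.
        by apply: cvgM; [exact: cvgN eps0|exact: cvg_cst].
      by rewrite oppr0 mul0r.
    by rewrite -[X in _ --> X]mulr1; apply: cvgM; exact: c.
  - move=> n xi; rewrite normrM ler_piMl// ger0_norm ?damping_le1//.
    exact: ltW (damping_gt0 _ _).
  - exact: integrable_norm.
have M0 : 0 <= M by exact: le_trans (normr_ge0 _) (hM 0).
pose G n p := \int[mu]_z (h (affine2 p (- eps n) z) * poisson2 1 z).
have GE n p : G n p = \int[mu]_q (h q * poisson2 (eps n) (p.1 - q.1, p.2 - q.2)).
  by rewrite poisson_convolution.
have lim2 : \int[mu]_p (f p * G n p) @[n --> \oo] -->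
    \int[mu]_p (f p * ((2 * pi) ^+ 2 * h p)).
  apply: (@Rint_dct _ _ _ mu _ _ (fun p => (M * (2 * pi) ^+ 2) * `|f p|)).
  - move=> n; apply: measurable_funM; first exact: intg_meas fi.
    apply: eq_measurable_fun (measurable_convolution (eps_gt0 n) hi).
    by move=> p _; rewrite GE.
  - move=> p; have [->|fp] := eqVneq (f p) 0.
      by under eq_fun do rewrite mul0r; rewrite mul0r; exact: cvg_cst.
    apply: cvgM; first exact: cvg_cst.
    exact: cvg_convolution (ch p fp).
  - move=> n p; rewrite normrM mulrC ler_wpM2r//.
    rewrite -Rint_poisson2 -RintegralZl//; last exact: intg_poisson2.
    have hpi : intg mu (fun z => h (affine2 p (- eps n) z) * poisson2 1 z).
      apply: (le_intg _ _ (intgZ M intg_poisson2)).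
        apply: measurable_funM; last exact: measurable_poisson2.
        apply: measurableT_comp (intg_meas hi) _; exact: measurable_affine2.
      move=> z; rewrite normrM (ger0_norm (poisson2_ge0 _ _))//.
      by rewrite ler_wpM2r ?poisson2_ge0.
    apply: (le_trans (le_normr_Rintegral _ hpi)) => //.
    apply: le_Rintegral => //.
    + exact: integrable_norm.
    + exact: (intgZ M intg_poisson2).
    + move=> z _; rewrite normrM (ger0_norm (poisson2_ge0 _ _))//.
      by rewrite ler_wpM2r ?poisson2_ge0.
  - exact: intgZ (integrable_norm fi).
have lim3 : \int[mu]_p (f p * G n p) @[n --> \oo] --> \int[mu]_xi I xi.
  apply: cvg_trans lim1; apply: near_eq_cvg; near=> n.
  rewrite (damped_parseval (eps_gt0 n) fi hi); apply: eq_Rintegral => p _.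
  by rewrite GE.
have fhi : intg mu (fun p => f p * h p).
  apply: (le_intg _ _ (intgZ M (integrable_norm fi))).
    by apply: measurable_funM; [exact: intg_meas fi|exact: intg_meas hi].
  by move=> p; rewrite normrM mulrC ler_wpM2r.
rewrite (cvg_unique _ lim3 lim2)// -RintegralZl//.
by apply: eq_Rintegral => p _; rewrite mulrCA.
Unshelve. all: by end_near. Qed.

End Parseval.

(** * Truncations to discs *)
Section Plancherel.
Variable R : realType.
Local Notation mu := (leb2 R).
Local Notation plane := (measurableTypeR R * measurableTypeR R)%type.
Implicit Types (f h : R * R -> R) (p q xi : R * R) (r l : R).

Lemma L2_sqint f : L2 f -> sqint mu f.
Proof. by move=> hf; exact: (Lfun2_sqint hf). Qed.

Definition cutoff r f : R * R -> R := f \_ (disc r).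

Lemma cutoffE r f p : cutoff r f p = if dot2 p p <= r ^+ 2 then f p else 0.
Proof. by rewrite /cutoff patchE /disc mem_setE. Qed.

Lemma measurable_disc r : measurable (disc r : set plane).
Proof.
have m : measurable_fun setT (fun p : plane => dot2 p p).
  have f1 : measurable_fun setT (fst : plane -> measurableTypeR R) by exact: measurable_fst.
  have f2 : measurable_fun setT (snd : plane -> measurableTypeR R) by exact: measurable_snd.
  by apply: measurable_funD; apply: measurable_funM.
rewrite (_ : disc r = setT `&` (fun p : plane => dot2 p p) @^-1` `]-oo, r ^+ 2]%classic).
  exact: m.
by apply/seteqP; split => p /=; rewrite in_itv//= => -[].
Qed.

Lemma measurable_cutoff r f : measurable_fun setT (f : plane -> R) ->
  measurable_fun setT (cutoff r f : plane -> R).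
Proof.
move=> mf; apply/(measurable_restrictT _ (measurable_disc r)).
exact: measurable_funTS.
Qed.

Lemma le_cutoff r f p : `|cutoff r f p| <= `|f p|.
Proof. by rewrite cutoffE; case: ifP => // _; rewrite normr0. Qed.

Lemma sqint_damping : sqint mu (damping (1 : R)).
Proof.
split; first exact: intg_meas (intg_damping ltr01).
apply: eq_intg (intg_damping (e := 2) _) => // p.
rewrite /damping exprMn -!expRM_natl.
by congr (expR _ * expR _); lra.
Qed.

(** On a disc the damping factor is bounded below, so that the truncation is
    dominated by a product of two square-integrable functions. *)
Lemma intg_cutoff r f : sqint mu f -> intg mu (cutoff r f).
Proof.
move=> hf; have fi := integrable_norm (sqint_mul hf sqint_damping).
apply: (le_intg _ _ (intgZ (expR (`|r| + `|r|)) fi)).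
  by apply: measurable_cutoff; case: hf.
move=> p; rewrite cutoffE; case: ifPn => [pr|_]; last first.
  by rewrite normr0 mulr_ge0 ?expR_ge0 ?normr_ge0.
rewrite /= normrM (gtr0_norm (damping_gt0 _ _)) mulrCA ler_peMr//.
rewrite /damping -expRD -expRD -[leLHS]expR0 ler_expR.
have b x : x ^+ 2 <= r ^+ 2 -> `|x| <= `|r|.
  by move=> xr; rewrite -ler_sqr ?nnegrE// !real_normK ?num_real.
have := b p.1; have := b p.2; move: pr; rewrite /dot2 => pr b2 b1.
have {}b1 : `|p.1| <= `|r| by apply: b1; have := sqr_ge0 p.2; nra.
have {}b2 : `|p.2| <= `|r| by apply: b2; have := sqr_ge0 p.1; nra.
lra.
Qed.

Lemma Fcos_measurable f : intg mu f -> measurable_fun setT (Fcos f : plane -> R).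
Proof.
move=> fi; apply: (measurable_plane_kernel2 fi (intg_damping ltr01) (@measurable_cos_dot2 R)).
  by move=> z; exact: cos_max.
by move=> y; exact: damping_gt0.
Qed.

Lemma Fsin_measurable f : intg mu f -> measurable_fun setT (Fsin f : plane -> R).
Proof.
move=> fi; apply: (measurable_plane_kernel2 fi (intg_damping ltr01) (@measurable_sin_dot2 R)).
  by move=> z; exact: sin_max.
by move=> y; exact: damping_gt0.
Qed.

Lemma fourier_on_Re r f xi : complex.Re (fourier_on (disc r) f xi) = Fcos (cutoff r f) xi.
Proof.
rewrite /fourier_on /= Rintegral_mkcond; apply: eq_Rintegral => p _.
by rewrite -[LHS]/(cutoff r _ p) !cutoffE; case: ifP => // _; rewrite mul0r.
Qed.

Lemma fourier_on_Im r f xi : complex.Im (fourier_on (disc r) f xi) = - Fsin (cutoff r f) xi.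
Proof.
rewrite /fourier_on /= Rintegral_mkcond; congr (- _); apply: eq_Rintegral => p _.
by rewrite -[LHS]/(cutoff r _ p) !cutoffE; case: ifP => // _; rewrite mul0r.
Qed.

Lemma L2dist_near (F : nat -> R * R -> R[i]) (G : R * R -> R[i]) (e : R) :
  L2dist (F n) G @[n --> \oo] --> (0 : \bar R)%E -> 0 < e ->
  \forall n \near \oo, (\int[mu]_xi
    ((complex.Re (F n xi) - complex.Re (G xi)) ^+ 2 +
     (complex.Im (F n xi) - complex.Im (G xi)) ^+ 2)%:E <= e%:E)%E.
Proof.
move=> FG e0.
have nge0 (x : R[i]) : 0 <= ComplexField.Normc.normc x.
  by case: x => a b; exact: sqrtr_ge0.
have se0 : 0 < Num.sqrt e by rewrite sqrtr_gt0.
have : \forall n \near \oo, (L2dist (F n) G < (Num.sqrt e)%:E)%E.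
  have /fine_cvgP[fin lim] := FG.
  apply: filterS2 fin (cvgr_lt _ lim _ se0) => n fn.
  by rewrite -lte_fin /= fineK.
apply: filterS => n lt.
have -> : (\int[mu]_xi
    ((complex.Re (F n xi) - complex.Re (G xi)) ^+ 2 +
     (complex.Im (F n xi) - complex.Im (G xi)) ^+ 2)%:E =
  L2dist (F n) G `^ 2)%E.
  rewrite /L2dist powR_Lnorm//; apply: eq_integral => xi _.
  rewrite gee0_abs ?lee_fin ?nge0// poweR_EFin powR_mulrn.
    case: (F n xi) => a b; case: (G xi) => a' b' /=.
    by rewrite sqr_sqrtr// addr_ge0 ?sqr_ge0.
  by rewrite ?nge0.
have -> : e%:E = ((Num.sqrt e)%:E `^ 2)%E.
  by rewrite poweR_EFin powR_mulrn ?sqrtr_ge0// sqr_sqrtr ?ltW.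
apply: gt0_ler_poweR => //.
- by rewrite in_itv/= leey Lnorm_ge0.
- by rewrite in_itv/= leey lee_fin sqrtr_ge0.
- exact: ltW.
Qed.

End Plancherel.

(** * Parseval's identity for Fourier-Plancherel transforms *)
Section PlancherelLimit.
Variable R : realType.
Local Notation mu := (leb2 R).
Local Notation plane := (measurableTypeR R * measurableTypeR R)%type.
Implicit Types (f h C S : R * R -> R) (p q xi : R * R) (l : R) (r : nat -> R).

Definition dil l p : R * R := (l * p.1, l * p.2).

Lemma dilE l p : dil l p = affine2 (0, 0) l p.
Proof. by rewrite /dil /affine2 /= !add0r. Qed.

Lemma intg_dil l f : l != 0 -> intg mu f -> intg mu (fun p => f (dil l p)).
Proof.
by move=> l0 fi; apply: eq_intg (intg_affine2 (0, 0) l0 fi) => p; rewrite dilE.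
Qed.

Lemma Rint_dil l f : l != 0 -> intg mu f ->
  \int[mu]_p f (dil l p) = l ^- 2 * \int[mu]_p f p.
Proof.
move=> l0 fi; rewrite -(Rint_affine2 (0, 0) l0 fi).
by apply: eq_Rintegral => p _; rewrite dilE.
Qed.

Lemma measurable_dil l f : measurable_fun setT (f : plane -> R) ->
  measurable_fun setT (fun p : plane => f (dil l p)).
Proof.
move=> mf; under eq_fun do rewrite dilE.
by apply: measurableT_comp mf _; exact: measurable_affine2.
Qed.

Lemma sqint_dil l f : l != 0 -> sqint mu f -> sqint mu (fun p => f (dil l p)).
Proof.
move=> l0 [mf f2]; split; first exact: measurable_dil.
exact: (intg_dil l0 f2).
Qed.

Lemma L2cvg_dil a l (u : nat -> R * R -> R) g : l != 0 -> L2cvg mu u g ->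
  L2cvg mu (fun n p => a * u n (dil l p)) (fun p => a * g (dil l p)).
Proof.
move=> l0 [hg hu ug]; split.
- by apply: sqintZ; exact: sqint_dil.
- by apply: filterS hu => n un; apply: sqintZ; exact: sqint_dil.
have : a ^+ 2 * (l ^- 2 * \int[mu]_p ((u n p - g p) ^+ 2)) @[n --> \oo] -->
    a ^+ 2 * (l ^- 2 * 0).
  by apply: cvgM; [exact: cvg_cst|apply: cvgM => //; exact: cvg_cst].
rewrite !mulr0; apply: cvg_trans; apply: near_eq_cvg.
apply: filterS hu => n un.
have [_ i2] := sqintB un hg.
rewrite -(Rint_dil l0 i2) -RintegralZl//; last exact: (intg_dil l0 i2).
by apply: eq_Rintegral => p _; ring.
Qed.

(** C and S are the mean-square limits of the cosine and sine transforms of f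
    truncated at the radii r n.  The radii are arbitrary because a dilation of f
    rescales them. *)
Definition fourier_lim f r C S :=
  L2cvg mu (fun n => Fcos (cutoff (r n) f)) C /\
  L2cvg mu (fun n => Fsin (cutoff (r n) f)) S.

Lemma is_fourier_lim f (F : R * R -> R[i]) : is_fourier f F ->
  fourier_lim f (fun n => n%:R) (fun xi => complex.Re (F xi))
    (fun xi => - complex.Im (F xi)).
Proof.
move=> [/L2_sqint hf /L2_sqint hre /L2_sqint him lim].
have small e : 0 < e -> \forall n \near \oo, (\int[mu]_xi
    ((Fcos (cutoff n%:R f) xi - complex.Re (F xi)) ^+ 2 +
     (- Fsin (cutoff n%:R f) xi - complex.Im (F xi)) ^+ 2)%:E <= e%:E)%E.
  move=> e0; apply: filterS (L2dist_near lim e0) => n.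
  by under eq_integral do rewrite fourier_on_Re fourier_on_Im.
have mc n : measurable_fun setT (Fcos (cutoff n%:R f) : plane -> R).
  by apply: Fcos_measurable; exact: intg_cutoff.
have ms n : measurable_fun setT (Fsin (cutoff n%:R f) : plane -> R).
  by apply: Fsin_measurable; exact: intg_cutoff.
have mre : measurable_fun setT (fun xi : plane => complex.Re (F xi)) by case: hre.
have mim : measurable_fun setT (fun xi : plane => complex.Im (F xi)) by case: him.
split.
- apply: (@near_L2cvg _ _ _ mu _ _ (fun n xi => - Fsin (cutoff n%:R f) xi - complex.Im (F xi))) => //.
  by move=> n; apply: measurable_funB => //; exact: measurable_funN.
- apply: (@near_L2cvg _ _ _ mu _ _ (fun n xi => Fcos (cutoff n%:R f) xi - complex.Re (F xi))) => //.
  + by apply: eq_sqint (sqintZ (-1) him) => xi; rewrite mulN1r.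
  + by move=> n; apply: measurable_funB.
  + move=> e e0; apply: filterS (small e e0) => n.
    apply: le_trans; rewrite le_eqVlt; apply/orP; left; apply/eqP.
    by apply: eq_integral => xi _; congr EFin; ring.
Qed.

Lemma fourier_lim_sub f r C S (k : nat -> nat) : k n @[n --> \oo] --> \oo ->
  fourier_lim f r C S -> fourier_lim f (r \o k) C S.
Proof. by move=> koo [hC hS]; split; [exact: L2cvg_sub koo hC|exact: L2cvg_sub koo hS]. Qed.

Lemma cutoff_dil l (r0 : R) f p : 0 < l ->
  cutoff (r0 / l) (fun p => f (dil l p)) p = cutoff r0 f (dil l p).
Proof.
move=> l0; rewrite !cutoffE; congr (if _ then _ else _).
rewrite /dot2 /dil /= expr_div_n ler_pdivlMr ?exprn_gt0//.
by congr (_ <= _); ring.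
Qed.

Lemma dot2_dil l p xi : l != 0 -> dot2 p xi = dot2 (dil l p) (dil l^-1 xi).
Proof. by move=> l0; rewrite /dot2 /dil /=; field. Qed.

Lemma Fcos_dil l (r0 : R) f xi : 0 < l -> sqint mu f ->
  Fcos (cutoff (r0 / l) (fun p => f (dil l p))) xi =
  l ^- 2 * Fcos (cutoff r0 f) (dil l^-1 xi).
Proof.
move=> l0 hf; have l0' : l != 0 by rewrite gt_eqF.
rewrite /Fcos -(Rint_dil l0' (f := fun p => cutoff r0 f p * cos (dot2 p (dil l^-1 xi)))).
  apply: eq_Rintegral => p _.
  by rewrite cutoff_dil// (dot2_dil p xi l0').
apply: intg_bdd; first exact: intg_cutoff.
  exact: (measurable_section1 (@measurable_cos_dot2 R)).
by move=> p; exact: cos_max.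
Qed.

Lemma Fsin_dil l (r0 : R) f xi : 0 < l -> sqint mu f ->
  Fsin (cutoff (r0 / l) (fun p => f (dil l p))) xi =
  l ^- 2 * Fsin (cutoff r0 f) (dil l^-1 xi).
Proof.
move=> l0 hf; have l0' : l != 0 by rewrite gt_eqF.
rewrite /Fsin -(Rint_dil l0' (f := fun p => cutoff r0 f p * sin (dot2 p (dil l^-1 xi)))).
  apply: eq_Rintegral => p _.
  by rewrite cutoff_dil// (dot2_dil p xi l0').
apply: intg_bdd; first exact: intg_cutoff.
  exact: (measurable_section1 (@measurable_sin_dot2 R)).
by move=> p; exact: sin_max.
Qed.

Lemma fourier_lim_dil l f r C S : 0 < l -> sqint mu f -> fourier_lim f r C S ->
  fourier_lim (fun p => f (dil l p)) (fun n => r n / l)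
    (fun xi => l ^- 2 * C (dil l^-1 xi)) (fun xi => l ^- 2 * S (dil l^-1 xi)).
Proof.
move=> l0 hf [hC hS]; have l0' : l^-1 != 0 by rewrite invr_eq0 gt_eqF.
have E (u v : nat -> R * R -> R) g : (forall n xi, u n xi = v n xi) ->
    L2cvg mu u g -> L2cvg mu v g.
  by move=> uv; have -> : v = u by apply/funext => n; apply/funext => xi.
split.
- by apply: E (L2cvg_dil (l ^- 2) l0' hC) => n xi; rewrite Fcos_dil.
- by apply: E (L2cvg_dil (l ^- 2) l0' hS) => n xi; rewrite Fsin_dil.
Qed.

Lemma cutoff_bounded (r0 : R) h : continuous h ->
  exists M, forall p, `|cutoff r0 h p| <= M.
Proof.
move=> ch.
have cK : compact (`[- `|r0|, `|r0|] `*` `[- `|r0|, `|r0|] : set (R * R)).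
  by apply: compact_setX; exact: segment_compact.
have : compact (h @` (`[- `|r0|, `|r0|] `*` `[- `|r0|, `|r0|])).
  by apply: continuous_compact => //; exact: continuous_subspaceT.
move=> /compact_bounded[M [_ /(_ (M + 1)) bM]]; exists `|M + 1| => p.
rewrite cutoffE; case: ifPn => [pr|_]; last by rewrite normr0.
rewrite (le_trans _ (ler_norm _))//; apply: bM; first by rewrite ltrDl.
exists p => //.
have b x : x ^+ 2 <= r0 ^+ 2 -> - `|r0| <= x <= `|r0|.
  by move=> xr; rewrite -ler_norml -ler_sqr ?nnegrE// !real_normK ?num_real.
move: pr; rewrite /dot2 => pr.
split; rewrite /= in_itv/=; apply: b.
- by have := sqr_ge0 p.2; nra.
- by have := sqr_ge0 p.1; nra.
Qed.

Lemma continuous_dot2 : continuous (fun p => dot2 p p).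
Proof.
move=> p; apply: cvgD; apply: cvgM.
- exact: cvg_fst.
- exact: cvg_fst.
- exact: cvg_snd.
- exact: cvg_snd.
Qed.

Lemma cutoff_continuous (r0 : R) h p : continuous h -> dot2 p p < r0 ^+ 2 ->
  {for p, continuous (cutoff r0 h)}.
Proof.
move=> ch pr; rewrite /prop_for /continuous_at cutoffE ifT ?ltW//.
apply: cvg_trans (ch p); apply: near_eq_cvg.
have lt : \forall q \near p, dot2 q q < r0 ^+ 2.
  by apply: (cvgr_lt _ (@continuous_dot2 p)).
by apply: filterS lt => q qr; rewrite cutoffE ifT ?ltW.
Qed.

(** The larger radii r' keep the circle on which the truncation of h jumps away
    from the support of the truncation of f. *)
Lemma parseval_lim f h r r' C S C' S' : sqint mu f -> sqint mu h -> continuous h ->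
  fourier_lim f r C S -> fourier_lim h r' C' S' ->
  (forall n, 0 <= r n < r' n) -> r n @[n --> \oo] --> +oo ->
  \int[mu]_xi (C xi * C' xi + S xi * S' xi) =
  (2 * pi) ^+ 2 * \int[mu]_p (f p * h p).
Proof.
move=> hf hh ch [fC fS] [hC hS] rr roo.
have lim1 : \int[mu]_xi (Fcos (cutoff (r n) f) xi * Fcos (cutoff (r' n) h) xi) +
    \int[mu]_xi (Fsin (cutoff (r n) f) xi * Fsin (cutoff (r' n) h) xi) @[n --> \oo] -->
    \int[mu]_xi (C xi * C' xi) + \int[mu]_xi (S xi * S' xi).
  by apply: cvgD; exact: L2cvg_mul.
have lim2 : \int[mu]_p cutoff (r n) (fun p => f p * h p) p @[n --> \oo] -->
    \int[mu]_p (f p * h p).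
  apply: (@Rint_dct _ _ _ mu _ _ (fun p => `|f p * h p|)).
  - move=> n; apply: measurable_cutoff; apply: measurable_funM; [by case: hf|by case: hh].
  - move=> p; have : \forall n \near \oo, f p * h p = cutoff (r n) (fun p => f p * h p) p.
      have H : \forall n \near \oo, dot2 p p + 1 <= r n by move: roo => /cvgryPge; apply.
      near=> n.
      rewrite cutoffE ifT//.
      have : dot2 p p + 1 <= r n by near: n; exact: H.
      have : 0 <= dot2 p p by rewrite addr_ge0// -expr2 sqr_ge0.
      nra.
    move=> /near_eq_cvg => E; apply: cvg_trans E _; exact: cvg_cst.
  - by move=> n p; exact: le_cutoff.
  - exact: (integrable_norm (sqint_mul hf hh)).
have lim3 : (2 * pi) ^+ 2 * \int[mu]_p cutoff (r n) (fun p => f p * h p) p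
    @[n --> \oo] --> \int[mu]_xi (C xi * C' xi) + \int[mu]_xi (S xi * S' xi).
  apply: cvg_trans lim1; apply: near_eq_cvg.
  have [_ a1 _] := fC; have [_ a2 _] := fS; have [_ a3 _] := hC; have [_ a4 _] := hS.
  near=> n.
  have b1 : sqint mu (Fcos (cutoff (r n) f)) by near: n.
  have b2 : sqint mu (Fsin (cutoff (r n) f)) by near: n.
  have b3 : sqint mu (Fcos (cutoff (r' n) h)) by near: n.
  have b4 : sqint mu (Fsin (cutoff (r' n) h)) by near: n.
  have [M hM] := cutoff_bounded (r' n) ch.
  have /andP[rn0 rn] := rr n.
  rewrite -RintegralD//; [|exact: sqint_mul|exact: sqint_mul].
  rewrite (parseval_L1 _ _ hM)//.
  - congr (_ * _); apply: eq_Rintegral => p _; rewrite !cutoffE.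
    case: ifPn => [pr|_]; last by rewrite mul0r.
    by rewrite ifT//; nra.
  - exact: intg_cutoff.
  - exact: intg_cutoff.
  - move=> p; rewrite cutoffE; case: ifPn => [pr _|_]; last by rewrite eqxx.
    apply: cutoff_continuous => //.
    by nra.
  - by apply: intgD; exact: sqint_mul.
have lim4 : (2 * pi) ^+ 2 * \int[mu]_p cutoff (r n) (fun p => f p * h p) p
    @[n --> \oo] --> (2 * pi) ^+ 2 * \int[mu]_p (f p * h p).
  by apply: cvgM => //; exact: cvg_cst.
rewrite -(cvg_unique _ lim3 lim4)// RintegralD//.
- by apply: sqint_mul; [case: fC|case: hC].
- by apply: sqint_mul; [case: fS|case: hS].
Unshelve. all: by end_near. Qed.

End PlancherelLimit.

(** * The chain rule along rays *)
Section RadialDerivative.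
Variable R : realType.
Implicit Types (phi : R * R -> R) (p q : R * R) (e : R).

Lemma is_derive_estimate (g : R -> R) (t D : R) :
  (forall e, 0 < e -> \forall h \near (0 : R), `|g (h + t) - g t - h * D| <= e * `|h|) ->
  is_derive t 1 g D.
Proof.
move=> gD.
have lim : h^-1 *: (g (h *: 1 + t) - g t) @[h --> 0^'] --> D.
  apply/cvgrPdist_le => e e0.
  have := gD e e0; rewrite /nbhs /= => -[d d0 H].
  exists d => //= h hd h0.
  have := H h hd.
  have -> : h *: (1 : R) = h by rewrite /GRing.scale/= mulr1.
  have -> : D - h^-1 *: (g (h + t) - g t) = - h^-1 * (g (h + t) - g t - h * D).
    by rewrite /GRing.scale/=; field.
  rewrite normrM normrN normfV => le.
  by rewrite mulrC ler_pdivrMr// normr_gt0.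
apply: DeriveDef; first by apply/cvg_ex; exists D.
exact: cvg_lim lim.
Qed.

Lemma MVT_between (g dg : R -> R) (a b : R) :
  (forall t : R, is_derive t (1 : R) g (dg t)) ->
  exists2 c, `|c - a| <= `|b - a| & g b - g a = (b - a) * dg c.
Proof.
move=> gd.
have cg : continuous g.
  move=> t; apply: differentiable_continuous; apply/derivable1_diffP.
  by have [] := gd t.
have [ab|ba|->] := ltgtP a b.
- have [c cab ->] := MVT ab (fun t _ => gd t) (continuous_subspaceT cg).
  exists c; last by rewrite mulrC.
  by move: cab; rewrite in_itv/= => /andP[h1 h2]; rewrite !ger0_norm; lra.
- have [c cab E] := MVT ba (fun t _ => gd t) (continuous_subspaceT cg).
  exists c; last by rewrite -opprB E; ring.
  by move: cab; rewrite in_itv/= => /andP[h1 h2]; rewrite !ler0_norm; lra.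
- by exists b; rewrite ?subrr ?mul0r.
Qed.

Lemma is_derive_dx phi x y : C1 phi ->
  is_derive (x : R) (1 : R) (fun t : R => phi (t, y)) (dx phi (x, y)).
Proof.
move=> [d1 _ _ _].
have E : (fun h : R => h^-1 *: (phi (h *: 1 + x, y) - phi (x, y))) =
    (fun h : R => h^-1 *: (phi (h *: ((1, 0) : R * R) + (x, y)) - phi (x, y))).
  apply/funext => h; congr (_ *: (phi _ - _)).
  by congr (_, _); rewrite /= /GRing.scale/= mulr0 add0r.
apply: DeriveDef; rewrite /derivable /derive /dx /derive /= E.
  exact: d1.
by [].
Qed.

Lemma is_derive_dy phi x y : C1 phi ->
  is_derive (y : R) (1 : R) (fun t : R => phi (x, t)) (dy phi (x, y)).
Proof.
move=> [_ _ d2 _].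
have E : (fun h : R => h^-1 *: (phi (x, h *: 1 + y) - phi (x, y))) =
    (fun h : R => h^-1 *: (phi (h *: ((0, 1) : R * R) + (x, y)) - phi (x, y))).
  apply/funext => h; congr (_ *: (phi _ - _)).
  by congr (_, _); rewrite /= /GRing.scale/= mulr0 add0r.
apply: DeriveDef; rewrite /derivable /derive /dy /derive /= E.
  exact: d2.
by [].
Qed.

(** Continuous partial derivatives give differentiability: move first along the
    second axis and then along the first, with the mean value theorem for each. *)
Lemma C1_estimate phi p e : C1 phi -> 0 < e ->
  exists2 d, 0 < d & forall h k, `|h| < d -> `|k| < d ->
    `|phi (p.1 + h, p.2 + k) - phi p - h * dx phi p - k * dy phi p|
      <= e * (`|h| + `|k|).
Proof.
move=> hphi e0; case: p => x y; have [_ cx _ cy] := hphi.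
have /cvgrPdist_le/(_ e e0) := cx (x, y).
have /cvgrPdist_le/(_ e e0) := cy (x, y).
move=> /nbhs_ballP[d1 /= d10 H1] /nbhs_ballP[d2 /= d20 H2].
exists (Num.min d1 d2); first by rewrite lt_min d10.
move=> h k; rewrite !lt_min => /andP[h1 h2] /andP[k1 k2] /=.
have [c c1 E1] := MVT_between x (x + h) (fun t => is_derive_dx t (y + k) hphi).
have [c' c2 E2] := MVT_between y (y + k) (fun t => is_derive_dy x t hphi).
have -> : phi (x + h, y + k) - phi (x, y) - h * dx phi (x, y) - k * dy phi (x, y) =
    h * (dx phi (c, y + k) - dx phi (x, y)) + k * (dy phi (x, c') - dy phi (x, y)).
  have -> : phi (x + h, y + k) - phi (x, y) =
    (phi (x + h, y + k) - phi (x, y + k)) + (phi (x, y + k) - phi (x, y)) by ring.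
  by rewrite E1 E2; ring.
have hx : `|dx phi (c, y + k) - dx phi (x, y)| <= e.
  rewrite distrC; apply: H2; split => /=.
    by rewrite /ball/= distrC (le_lt_trans c1)// addrAC subrr add0r.
  by rewrite /ball/= opprD addNKr normrN.
have hy : `|dy phi (x, c') - dy phi (x, y)| <= e.
  rewrite distrC; apply: H1; split => /=; first by rewrite /ball/= subrr normr0.
  by rewrite /ball/= distrC (le_lt_trans c2)// addrAC subrr add0r.
move: (dx phi (c, y + k) - _) (dy phi (x, c') - _) hx hy => X Y hx hy.
rewrite (le_trans (ler_normD _ _))// !normrM mulrDr lerD//.
  by rewrite mulrC ler_wpM2r.
by rewrite mulrC ler_wpM2r.
Qed.

Lemma C1_continuous phi : C1 phi -> continuous phi.
Proof.
move=> hphi p.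
apply/cvgrPdist_le => e e0.
have [d d0 H] := C1_estimate p hphi ltr01.
move: (dx phi p) (dy phi p) H => X Y H.
pose K := 1 + `|X| + `|Y|.
have K0 : 0 < K by rewrite /K ltr_wpDr// ltr_wpDr.
pose r := Num.min d (e / K / 2).
have r0 : 0 < r by rewrite lt_min d0 !divr_gt0.
have : nbhs p (ball p r) by exact: nbhsx_ballx.
apply: filterS => q [q1 q2].
have := H (q.1 - p.1) (q.2 - p.2).
move: q1 q2; rewrite /ball/= !lt_min -![`|p.1 - _|]distrC => /andP[a1 a2].
rewrite -![`|p.2 - _|]distrC => /andP[b1 b2] /(_ a1 b1).
rewrite !(addrC p.1) !(addrC p.2) !subrK -surjective_pairing mul1r.
move: a2 b2; set h := q.1 - p.1; set k := q.2 - p.2 => a2 b2 le.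
rewrite distrC.
have -> : phi q - phi p = (phi q - phi p - h * X - k * Y) +
  (h * X + k * Y) by ring.
rewrite (le_trans (ler_normD _ _))//.
have s1 : `|h * X + k * Y| <= `|h| * `|X| + `|k| * `|Y|.
  by rewrite (le_trans (ler_normD _ _))// !normrM.
have : (`|h| + `|k|) * K <= e.
  by rewrite -ler_pdivlMr//; lra.
move: (normr_ge0 h) (normr_ge0 k) (normr_ge0 X) (normr_ge0 Y).
rewrite /K; move: le s1; move: `|h| `|k| `|X| `|Y|.
move=> a b A B; nra.
Qed.

(** The derivative of t |-> phi (t p) at t = 1. *)
Definition radial phi p := p.1 * dx phi p + p.2 * dy phi p.

Lemma is_derive_dil phi p t : C1 phi ->
  is_derive (t : R) (1 : R) (fun u : R => phi (dil u p))
  (p.1 * dx phi (dil t p) + p.2 * dy phi (dil t p)).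
Proof.
move=> hphi; apply: is_derive_estimate => e e0.
pose K := `|p.1| + `|p.2| + 1.
have K0 : 0 < K by rewrite /K ltr_wpDl// addr_ge0.
have [d d0 H] := C1_estimate (dil t p) hphi (divr_gt0 e0 K0).
move: (dx phi (dil t p)) (dy phi (dil t p)) H => X Y H.
have : nbhs (0 : R) (ball (0 : R) (d / K)) by apply: nbhsx_ballx; exact: divr_gt0.
apply: filterS => h; rewrite /ball/= sub0r normrN ltr_pdivlMr// => hd.
have hh x : `|x| <= K -> `|h * x| < d.
  by move=> xK; rewrite normrM (le_lt_trans _ hd)// ler_wpM2l.
have := H (h * p.1) (h * p.2) (hh _ _) (hh _ _).
have k1 : `|p.1| <= K by rewrite /K; have := normr_ge0 p.2; lra.
have k2 : `|p.2| <= K by rewrite /K; have := normr_ge0 p.1; lra.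
move=> /(_ k1 k2).
rewrite /dil /= -!mulrDl ![t + h]addrC.
set A := phi _; set B := phi _ => le.
have -> : A - B - h * (p.1 * X + p.2 * Y) = A - B - h * p.1 * X - h * p.2 * Y by ring.
apply: (le_trans le); rewrite !normrM -mulrDr mulrCA mulrC ler_wpM2r//.
rewrite mulrAC ler_pdivrMr// ler_wpM2l ?ltW// /K; lra.
Qed.

Lemma continuous_radial_path phi p : C1 phi -> continuous
  (fun t => p.1 * dx phi (dil t p) + p.2 * dy phi (dil t p)).
Proof.
move=> [_ cx _ cy] t.
have c (x : R) : u * x @[u --> t] --> t * x.
  by apply: cvgM; [exact: cvg_id|exact: cvg_cst].
have cd : dil u p @[u --> t] --> dil t p by exact: (cvg_pair (c p.1) (c p.2)).
apply: cvgD; apply: cvgM; try exact: cvg_cst.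
  exact: (cvg_comp _ _ cd (cx _)).
exact: (cvg_comp _ _ cd (cy _)).
Qed.

Lemma radial_dil phi p t : radial phi (dil t p) =
  t * (p.1 * dx phi (dil t p) + p.2 * dy phi (dil t p)).
Proof. by rewrite /radial /dil /=; ring. Qed.

End RadialDerivative.

(** * Increments under dilation *)
Section DilationDerivative.
Variable R : realType.
Local Notation leb := (@lebesgue_measure R).
Local Notation mu := (leb2 R).
Local Notation plane := (measurableTypeR R * measurableTypeR R)%type.
Implicit Types (phi u : R * R -> R) (p q : R * R) (a b : R).

(** The variance of v over the interval is nonnegative. *)
Lemma jensen_sqr (v : R -> R) a b : a < b -> continuous v ->
  (\int[leb]_(t in `[a, b]) v t) ^+ 2 <= (b - a) * \int[leb]_(t in `[a, b]) (v t ^+ 2).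
Proof.
move=> ab cv.
have ic (g : R -> R) : continuous g -> leb.-integrable `[a, b] (EFin \o g).
  move=> cg; apply: continuous_compact_integrable; first exact: segment_compact.
  exact: continuous_subspaceT.
set I := \int[leb]_(t in _) v t.
pose k := I / (b - a).
have iv := ic v cv.
have iv2 : leb.-integrable `[a, b] (EFin \o (fun t => v t ^+ 2)).
  by apply: ic => t; apply: cvgM; exact: cv.
have ivk : leb.-integrable `[a, b] (EFin \o (fun t => (2 * k) * v t)).
  by apply: ic => t; apply: cvgM; [exact: cvg_cst|exact: cv].
have ik : leb.-integrable `[a, b] (EFin \o (fun t => k ^+ 2 : R)).
  by apply: ic => t; exact: cvg_cst.
have : 0 <= \int[leb]_(t in `[a, b]) (v t ^+ 2 - 2 * k * v t + k ^+ 2).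
  by apply: Rintegral_ge0 => t _; have := sqr_ge0 (v t - k); lra.
have mab : measurable (`[a, b]%classic : set (measurableTypeR R)) by exact: measurable_itv.
rewrite RintegralD//=; last by have := integrableB mab iv2 ivk.
have lab : leb `[a, b]%classic = (b - a)%:E by rewrite lebesgue_measure_itv/= lte_fin ab.
rewrite RintegralB// RintegralZl// Rintegral_cst// -/I.
rewrite (_ : fine _ = b - a); last by rewrite [X in fine X]lab.
set J := \int[leb]_(t in _) _.
have ba : 0 < b - a by rewrite subr_gt0.
have -> : J - 2 * k * I + k ^+ 2 * (b - a) = J - I ^+ 2 / (b - a).
  by rewrite /k; field; rewrite gt_eqF.
by rewrite subr_ge0 ler_pdivrMr// mulrC.
Qed.

Lemma ray_increment phi p a b : C1 phi -> a < b ->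
  phi (dil b p) - phi (dil a p) =
  \int[leb]_(t in `[a, b]) (p.1 * dx phi (dil t p) + p.2 * dy phi (dil t p)).
Proof.
move=> hphi ab.
have D t := is_derive_dil p t hphi.
have cF : continuous (fun t => phi (dil t p)).
  move=> t; apply: differentiable_continuous; apply/derivable1_diffP.
  by have [] := D t.
rewrite /Rintegral (@continuous_FTC2 _ _ (fun t => phi (dil t p)))//.
- by apply: continuous_subspaceT; exact: continuous_radial_path.
- split.
  + by move=> t _; have [] := D t.
  + by apply: cvg_at_right_filter; exact: cF.
  + by apply: cvg_at_left_filter; exact: cF.
- by move=> t _; rewrite derive1E; have [_ ->] := D t.
Qed.

(** The derivative of u |-> phi (u p) is the radial derivative at u p divided
    by u; on [a, b] the division costs at most a ^ - 2 after squaring, and the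
    change of variables p |-> u p costs another a ^ - 2. *)
Lemma dil_increment_bound phi a b : C1 phi -> sqint mu phi -> sqint mu (radial phi) ->
  0 < a -> a < b ->
  \int[mu]_p ((phi (dil b p) - phi (dil a p)) ^+ 2) <=
  (b - a) ^+ 2 * (a ^- 4 * \int[mu]_p (radial phi p ^+ 2)).
Proof.
move=> hphi hs hr a0 ab.
have b0 : 0 < b by exact: lt_trans ab.
have ba : 0 < b - a by rewrite subr_gt0.
have [mr r2] := hr.
set W := \int[mu]_p (radial phi p ^+ 2).
have W0 : 0 <= W by apply: Rintegral_ge0 => p _; exact: sqr_ge0.
pose f (z : plane * measurableTypeR R) : \bar R :=
  ((radial phi (dil z.2 z.1)) ^+ 2 * \1_(`[a, b]%classic) z.2)%:E.
have f0 z : (0 <= f z)%E by rewrite lee_fin mulr_ge0// sqr_ge0.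
have mdil : measurable_fun setT (fun z : plane * measurableTypeR R => (dil z.2 z.1 : plane)).
  have m1 : measurable_fun setT (fst : plane * measurableTypeR R -> plane) by exact: measurable_fst.
  have m2 : measurable_fun setT (snd : plane * measurableTypeR R -> measurableTypeR R) by exact: measurable_snd.
  have f1 : measurable_fun setT (fst : plane -> measurableTypeR R) by exact: measurable_fst.
  have f2 : measurable_fun setT (snd : plane -> measurableTypeR R) by exact: measurable_snd.
  apply: measurable_fun_pair; apply: measurable_funM => //.
  - exact: (measurableT_comp f1 m1).
  - exact: (measurableT_comp f2 m1).
have mf : measurable_fun setT f.
  apply/measurable_EFinP; apply: measurable_funM.
    by apply: measurable_funX; exact: measurableT_comp mr mdil.
  apply: (measurableT_comp (f := \1_(`[a, b]%classic) : measurableTypeR R -> R)).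
    by apply: measurable_indic; exact: measurable_itv.
  exact: measurable_snd.
have pointwise p : (((phi (dil b p) - phi (dil a p)) ^+ 2)%:E <=
    ((b - a) * a ^- 2)%:E * \int[leb]_t f (p, t))%E.
  pose v t := p.1 * dx phi (dil t p) + p.2 * dy phi (dil t p).
  have cv : continuous v by exact: continuous_radial_path.
  have cv2 : continuous (fun t => v t ^+ 2) by move=> t; apply: cvgM; exact: cv.
  have iv2 : leb.-integrable `[a, b] (EFin \o (fun t => v t ^+ 2)).
    apply: continuous_compact_integrable; first exact: segment_compact.
    exact: continuous_subspaceT.
  rewrite ray_increment//.
  apply: (@le_trans _ _ ((b - a) * \int[leb]_(t in `[a, b]) (v t ^+ 2))%:E).
    by rewrite lee_fin jensen_sqr.
  rewrite !EFinM -muleA lee_pmul2l ?lte_fin//.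
  rewrite fineK; last exact: integrable_fin_num.
  rewrite -ge0_integralZl//; last 2 first.
  - exact: measurable_fun_pair2.
  - by rewrite lee_fin invr_ge0 sqr_ge0.
  rewrite integral_mkcond; apply: ge0_le_integral => //.
  - by move=> t _; rewrite patchE; case: ifP => // _; rewrite lee_fin sqr_ge0.
  - apply/(measurable_restrictT _ (measurable_itv _)).
    by apply/measurable_EFinP; apply: measurable_funTS; exact: continuous_measurable_fun.
  - by apply: measurable_funeM; exact: measurable_fun_pair2.
  move=> t _; rewrite patchE; case: ifPn => [tab|tab]; last first.
    by rewrite mule_ge0// lee_fin invr_ge0 sqr_ge0.
  rewrite /f /= indicE tab mulr1 -EFinM lee_fin radial_dil -/(v t).
  move: tab; rewrite inE/= in_itv/= => /andP[at_ _].
  rewrite exprMn mulrA ler_peMl ?sqr_ge0// mulrC -[leLHS](@mulfV _ (a ^+ 2)) ?expf_neq0 ?gt_eqF//.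
  by rewrite ler_wpM2r ?invr_ge0 ?sqr_ge0// lerXn2r ?nnegrE ?(ltW a0)// (le_trans (ltW a0)).
have hb : sqint mu (fun p => phi (dil b p)) by apply: sqint_dil => //; rewrite gt_eqF.
have ha : sqint mu (fun p => phi (dil a p)) by apply: sqint_dil => //; rewrite gt_eqF.
have [md d2] := sqintB hb ha.
rewrite -lee_fin -Rint_EFin//.
apply: (@le_trans _ _ (\int[mu]_p (((b - a) * a ^- 2)%:E * \int[leb]_t f (p, t)))%E).
  apply: ge0_le_integral => //.
  - by move=> p _; rewrite lee_fin sqr_ge0.
  - by apply/measurable_EFinP; exact: intg_meas d2.
  - by apply: measurable_funeM; exact: measurable_fun_fubini_tonelli_F.
rewrite ge0_integralZl//; last 3 first.
- exact: measurable_fun_fubini_tonelli_F.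
- by move=> p _; exact: integral_ge0.
- by rewrite lee_fin mulr_ge0 ?invr_ge0 ?sqr_ge0// ltW.
have -> : (\int[mu]_p \int[leb]_t f (p, t) = \int[leb]_t \int[mu]_p f (p, t))%E.
  exact: (@fubini_tonelli _ _ _ _ _ (sleb2 R) leb f mf f0).
have inner t : (\int[mu]_p f (p, t) <= (a ^- 2 * W * \1_(`[a, b]%classic) t)%:E)%E.
  rewrite /f /= indicE; case: (boolP (t \in _)) => [|_]; last first.
    by rewrite mulr0; under eq_integral do rewrite mulr0; rewrite integral0.
  rewrite inE/= in_itv/= => /andP[at_ _]; rewrite mulr1.
  under eq_integral do rewrite mulr1.
  have t0 : 0 < t by exact: lt_le_trans at_.
  have t0' : t != 0 by rewrite gt_eqF.
  rewrite Rint_EFin ?(Rint_dil t0' r2); last exact: (intg_dil t0' r2).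
  rewrite lee_fin ler_wpM2r// lef_pV2 ?posrE ?exprn_gt0//.
  by rewrite lerXn2r ?nnegrE// ltW.
apply: (@le_trans _ _ (((b - a) * a ^- 2)%:E *
    \int[leb]_t (a ^- 2 * W * \1_(`[a, b]%classic) t)%:E)%E).
  apply: lee_wpmul2l; first by rewrite lee_fin mulr_ge0 ?invr_ge0 ?sqr_ge0// ltW.
  apply: ge0_le_integral => //.
  - by move=> t _; exact: integral_ge0.
  - exact: (@measurable_fun_fubini_tonelli_G _ _ _ _ _ (sleb2 R) f mf f0).
  - apply/measurable_EFinP; apply: measurable_funM => //.
under eq_integral do rewrite EFinM.
rewrite ge0_integralZl//; last 2 first.
- by apply/measurable_EFinP.
- by rewrite lee_fin mulr_ge0// invr_ge0 sqr_ge0.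
have lab : leb `[a, b]%classic = (b - a)%:E by rewrite lebesgue_measure_itv/= lte_fin ab.
rewrite integral_indic// setIT [X in (_ * (_ * X))%E]lab -!EFinM lee_fin.
rewrite le_eqVlt; apply/orP; left; apply/eqP; field.
by rewrite gt_eqF.
Qed.

End DilationDerivative.

(** * Functions touching from below and weak radial derivatives *)
Section AlmostEverywhere.
Context d (T : measurableType d) (R : realType).
Variable mu : {measure set T -> \bar R}.
Implicit Types f g : T -> R.

Lemma ae_imply (P Q : T -> Prop) : (forall x, P x -> Q x) ->
  {ae mu, forall x, P x} -> {ae mu, forall x, Q x}.
Proof. by move=> PQ; apply: filterS. Qed.

Lemma ae_intg f g : measurable_fun setT f -> intg mu g ->
  {ae mu, forall x, f x = g x} ->
  intg mu f /\ \int[mu]_x f x = \int[mu]_x g x.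
Proof.
move=> mf gi fg.
have mf' : measurable_fun setT (EFin \o f) by exact/measurable_EFinP.
have mg' : measurable_fun setT (EFin \o g) by apply/measurable_EFinP; exact: intg_meas gi.
have fgE : ae_eq mu setT (EFin \o f) (EFin \o g).
  by apply: filterS fg => x /= -> _.
split; last by rewrite /Rintegral; congr fine; exact: ae_eq_integral.
apply/integrableP; split => //.
case/integrableP : gi => _; apply: le_lt_trans.
rewrite le_eqVlt; apply/orP; left; apply/eqP; apply: ge0_ae_eq_integral => //.
- exact: measurableT_comp.
- exact: measurableT_comp.
- by apply: filterS fg => x /= -> _.
Qed.

Lemma ae_sqint f g : measurable_fun setT f -> sqint mu g ->
  {ae mu, forall x, f x = g x} -> sqint mu f.
Proof.
move=> mf [mg g2] fg; split => //.
apply: (ae_intg _ g2 _).1; first exact: measurable_funX.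
by apply: filterS fg => x ->.
Qed.

End AlmostEverywhere.

Section Touching.
Variable R : realType.
Implicit Types (l : nat -> R) (I U : R -> R).

(** Sequences along which difference quotients at 1 are taken. *)
Definition punctured l := [/\ forall n, 0 < l n, forall n, l n != 1
  & l n @[n --> \oo] --> (1 : R)].

Lemma quotient_cvg (g : R -> R) (D : R) l : is_derive (1 : R) (1 : R) g D ->
  punctured l -> (g (l n) - g 1) / (l n - 1) @[n --> \oo] --> D.
Proof.
move=> [gd gD] [_ l1 ll].
have h0 : l n - 1 @[n --> \oo] --> 0^'.
  have h0 : l n - 1 @[n --> \oo] --> (0 : R).
    by rewrite -(subrr (1 : R)); apply: cvgB => //; exact: cvg_cst.
  move=> A HA.
  have key : \forall n \near \oo, (l n - 1 != 0 -> A (l n - 1)).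
    exact: (h0 (fun x => x != 0 -> A x) HA).
  by apply: filterS key => n; apply; rewrite subr_eq0; exact: l1.
have : h^-1 *: (g (h *: (1 : R) + 1) - g 1) @[h --> 0^'] --> D.
  by rewrite -gD; exact: gd.
move=> /(cvg_comp _ _ h0); apply: cvg_trans; apply: near_eq_cvg; apply: nearW => n /=.
by rewrite /GRing.scale/= mulr1 subrK mulrC.
Qed.

(** The difference quotients of I are bounded by those of U, from above on the
    right of 1 and from below on the left; the two one-sided limits compare D
    and d in both directions. *)
Lemma touching I U (D d : R) : (forall t, 0 < t -> I t <= U t) -> I 1 = U 1 ->
  is_derive (1 : R) (1 : R) U d ->
  (forall l, punctured l -> (I (l n) - I 1) / (l n - 1) @[n --> \oo] --> D) -> D = d.
Proof.
move=> IU I1 Ud ID.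
pose e n : R := n.+2%:R^-1.
have e0 n : 0 < e n by rewrite invr_gt0 ltr0n.
have e1 n : e n < 1 by rewrite invf_lt1 ?ltr0n// ltr1n.
have elim : e n @[n --> \oo] --> (0 : R).
  have := @cvg_harmonic R; rewrite -cvg_shiftS.
  by apply: cvg_trans; apply: near_eq_cvg; apply: nearW.
have pr : punctured (fun n => 1 + e n).
  split => [n|n|]; first by have := e0 n; lra.
    by rewrite gt_eqF// ltrDl.
  have : 1 + e n @[n --> \oo] --> (1 : R) + 0 by apply: cvgD => //; exact: cvg_cst.
  by rewrite addr0.
have pl : punctured (fun n => 1 - e n).
  split => [n|n|]; first by have := e1 n; lra.
    by rewrite lt_eqF// gtrBl.
  have : 1 - e n @[n --> \oo] --> (1 : R) - 0 by apply: cvgB => //; exact: cvg_cst.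
  by rewrite subr0.
apply/eqP; rewrite eq_le; apply/andP; split.
- apply: (ler_cvg_to (ID _ pr) (quotient_cvg Ud pr)).
  near=> n.
  rewrite I1 ler_pM2r ?lerD2r ?IU//; first by have [] := pr.
  by rewrite invr_gt0 addrAC subrr add0r.
- apply: (ler_cvg_to (quotient_cvg Ud pl) (ID _ pl)).
  near=> n.
  rewrite I1 ler_nM2r ?lerD2r ?IU//; first by have [] := pl.
  by rewrite invr_lt0 addrAC subrr add0r oppr_lt0.
Unshelve. all: by end_near. Qed.

End Touching.

Section WeakDerivative.
Variable R : realType.
Local Notation leb := (@lebesgue_measure R).
Local Notation mu := (leb2 R).
Local Notation plane := (measurableTypeR R * measurableTypeR R)%type.
Implicit Types (phi u : R * R -> R) (p q : R * R).

Lemma dil1 p : dil 1 p = p.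
Proof. by case: p => x y; rewrite /dil /= !mul1r. Qed.

(** [weak_cvg] applies to the difference quotients.  Their squared norms are at
    most (min 1 (l n)) ^ - 4 times that of the limit, by [dil_increment_bound] on
    the interval between 1 and l n. *)
Lemma dil_derivative phi u (l : nat -> R) : C1 phi -> sqint mu phi ->
  sqint mu (radial phi) -> sqint mu u -> punctured l ->
  (\int[mu]_p (phi (dil (l n) p) * u p) - \int[mu]_p (phi (dil 1 p) * u p)) / (l n - 1)
  @[n --> \oo] --> \int[mu]_p (radial phi p * u p).
Proof.
move=> hphi hs hr hu hl; have [l0 l1 ll] := hl.
have hd n : sqint mu (fun p => phi (dil (l n) p)) by apply: sqint_dil => //; rewrite gt_eqF.
pose q n p := (l n - 1)^-1 * (phi (dil (l n) p) - phi p).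
have hq n : sqint mu (q n) by apply: sqintZ; exact: sqintB.
(* C n bounds (min 1 (l n)) ^ - 4 and tends to 1. *)
pose C n := 1 + `|l n ^- 4 - 1|.
have C1' : C n @[n --> \oo] --> (1 : R).
  have l4 : l n ^- 4 @[n --> \oo] --> (1 : R) ^- 4.
    apply: cvgV; first by rewrite expf_neq0.
    exact: (cvg_comp _ _ ll (@exprn_continuous R 4 1)).
  have : C n @[n --> \oo] --> (1 : R) + `|1 ^- 4 - 1|.
    apply: cvgD; first exact: cvg_cst.
    by apply: cvg_norm; apply: cvgB => //; exact: cvg_cst.
  by rewrite expr1n invr1 subrr normr0 addr0.
have qC n : \int[mu]_p (q n p ^+ 2) <= C n * \int[mu]_p (radial phi p ^+ 2).
  have W0 : 0 <= \int[mu]_p (radial phi p ^+ 2).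
    by apply: Rintegral_ge0 => p _; exact: sqr_ge0.
  have d2 : intg mu (fun p => (phi (dil (l n) p) - phi p) ^+ 2).
    by case: (sqintB (hd n) hs).
  rewrite /q; under eq_Rintegral do rewrite exprMn.
  rewrite RintegralZl// exprVn.
  have d0 : 0 < (l n - 1) ^+ 2 by rewrite exprn_even_gt0//= subr_eq0.
  rewrite mulrC ler_pdivrMr//.
  have [lt1|gt1|E] := ltgtP (l n) 1.
  - have := dil_increment_bound hphi hs hr (l0 n) lt1.
    under eq_Rintegral do rewrite dil1 -sqrrN opprB.
    move=> /le_trans; apply; rewrite -sqrrN opprB mulrC ler_wpM2r ?sqr_ge0//.
    by rewrite ler_wpM2r// /C -lerBlDl ler_norm.
  - have := dil_increment_bound hphi hs hr ltr01 gt1.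
    under eq_Rintegral do rewrite dil1.
    move=> /le_trans; apply; rewrite mulrC ler_wpM2r ?sqr_ge0//.
    by rewrite ler_wpM2r// /C expr1n invr1 lerDl.
  - by have := l1 n; rewrite E eqxx.
have qw p : q n p @[n --> \oo] --> radial phi p.
  have D := is_derive_dil p 1 hphi.
  have := quotient_cvg D hl; rewrite !dil1.
  apply: cvg_trans; apply: near_eq_cvg; apply: nearW => n.
  by rewrite /q mulrC.
have := weak_cvg hq hr hu qw qC C1'.
apply: cvg_trans; apply: near_eq_cvg; apply: nearW => n.
have i1 := sqint_mul (hd n) hu.
have i2 := sqint_mul hs hu.
transitivity (\int[mu]_p ((l n - 1)^-1 * (phi (dil (l n) p) * u p - phi p * u p))).
  by apply: eq_Rintegral => p _; rewrite /q; ring.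
rewrite RintegralZl ?RintegralB//; last exact: (intgB i1 i2).
have -> : \int[mu]_p (phi (dil 1 p) * u p) = \int[mu]_p (phi p * u p).
  by apply: eq_Rintegral => p _; rewrite dil1.
by rewrite mulrC.
Qed.

Lemma continuous_ae0 (f : R * R -> R) : continuous f ->
  {ae mu, forall p, f p = 0} -> forall p, f p = 0.
Proof.
move=> cf [N [mN N0 fN]] p; apply/eqP/negPn/negP => fp.
have : \forall q \near p, f q != 0.
  exact: (cvgr_neq0 _ (cf p) fp).
move=> /nbhs_ballP[r /= r0 Hr].
pose box := `]p.1 - r, p.1 + r[%classic `*` `]p.2 - r, p.2 + r[%classic.
have mbox : measurable (box : set plane) by apply: measurableX; exact: measurable_itv.
have boxN : box `<=` N.
  move=> q [q1 q2]; apply: fN => /= fq; have := Hr q; rewrite fq eqxx => H.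
  suff : false by []. apply: H.
  move: q1 q2; rewrite /= !in_itv/= => /andP[a1 a2] /andP[b1 b2].
  by split; rewrite /ball/= ltr_distl; apply/andP; split; lra.
have : (mu box <= 0)%E by rewrite -N0; apply: le_measure => //; rewrite inE.
have lab x : leb `]x - r, x + r[%classic = (2 * r)%:E.
  rewrite lebesgue_measure_itv/= lte_fin ltrD2l gtrN ?r0//.
  by rewrite -EFinB; congr EFin; ring.
have -> : mu box = ((2 * r)%:E * (2 * r)%:E)%E.
  rewrite -{1}(lab p.1) -(lab p.2).
  by apply: product_measure1E; exact: measurable_itv.
by rewrite -EFinM lee_fin leNgt !mulr_gt0.
Qed.

End WeakDerivative.

(** * Upper bounds for the three dilated integrals *)
Section Bounds.
Variable R : realType.
Local Notation mu := (leb2 R).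
Local Notation plane := (measurableTypeR R * measurableTypeR R)%type.
Implicit Types (phi g : R * R -> R) (p q xi : R * R) (t s m : R).

Lemma powR_N2 t : 0 < t -> t `^ (- 2) = t ^- 2.
Proof. by move=> t0; rewrite powRN powR_mulrn// ltW. Qed.

Lemma self_bound phi t : sqint mu phi -> 0 < t ->
  \int[mu]_p (phi (dil t p) * phi p) <=
  (1 + t `^ (- 2)) / 2 * \int[mu]_p (phi (dil 1 p) * phi p).
Proof.
move=> hs t0; have t0' : t != 0 by rewrite gt_eqF.
have ht := sqint_dil t0' hs; have [_ p2] := hs; have [_ pt2] := ht.
have -> : \int[mu]_p (phi (dil 1 p) * phi p) = \int[mu]_p (phi p ^+ 2).
  by apply: eq_Rintegral => p _; rewrite dil1 expr2.
have -> : (1 + t `^ (- 2)) / 2 * \int[mu]_p (phi p ^+ 2) =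
    \int[mu]_p (2^-1 * (phi p ^+ 2 + phi (dil t p) ^+ 2)).
  rewrite RintegralZl//; last exact: (intgD p2 pt2).
  rewrite RintegralD// (Rint_dil t0' p2) powR_N2//; field.
  by rewrite gt_eqF.
apply: le_Rintegral => //.
- exact: (sqint_mul ht hs).
- exact: (intgZ _ (intgD p2 pt2)).
- move=> p _; have := sqr_ge0 (phi p - phi (dil t p)); lra.
Qed.

(** The nonlinearity of the equation, up to the factor nu2 / m. *)
Definition npow m (x : R) := `|x| `^ (m - 1) * x.

Lemma npowE m x : 1 < m -> x * npow m x = `|x| `^ (m + 1).
Proof.
move=> m1; rewrite /npow mulrCA -expr2 -real_normK ?num_real//.
rewrite -powR_mulrn// -powRD; first by congr (_ `^ _); ring.
by apply/implyP => /eqP; lra.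
Qed.

Lemma npow_norm m x : 1 < m -> `|npow m x| = `|x| `^ m.
Proof.
move=> m1; rewrite /npow normrM (ger0_norm (powR_ge0 _ _)).
rewrite -[X in _ * X]powRr1// -powRD; first by congr (_ `^ _); ring.
by apply/implyP => /eqP; lra.
Qed.

(** Young's inequality with the exponents (m + 1) / m and m + 1. *)
Lemma young_npow m (a b : R) : 1 < m ->
  b * npow m a <= (m * (a * npow m a) + b * npow m b) / (m + 1).
Proof.
move=> m1; have m0 : 0 < m by lra.
rewrite !npowE// (le_trans (ler_norm _))// normrM npow_norm// mulrC.
have := @conjugate_powR R (`|a| `^ m) `|b| ((m + 1) / m) (m + 1) (powR_ge0 _ _)
  (normr_ge0 _).
rewrite -powRrM; have -> : m * ((m + 1) / m) = m + 1 by field; rewrite gt_eqF.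
have h1 : 0 < (m + 1) / m by rewrite divr_gt0//; lra.
have h2 : 0 < m + 1 by lra.
have h3 : ((m + 1) / m)^-1 + (m + 1)^-1 = 1.
  by field; rewrite !gt_eqF.
move=> /(_ h1 h2 h3) /le_trans; apply; rewrite le_eqVlt; apply/orP; left; apply/eqP.
by field; rewrite !gt_eqF.
Qed.

Lemma measurable_npow m (f : plane -> R) : measurable_fun setT f ->
  measurable_fun setT (fun p => npow m (f p)).
Proof.
move=> mf; apply: measurable_funM => //.
apply: (@measurableT_comp _ _ _ _ _ _ (fun x : R => x `^ (m - 1))) => //.
exact: measurableT_comp.
Qed.

Lemma power_bound phi m t : 1 < m -> sqint mu phi ->
  sqint mu (fun p => npow m (phi p)) -> 0 < t ->
  \int[mu]_p (phi (dil t p) * npow m (phi p)) <=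
  (m + t `^ (- 2)) / (m + 1) * \int[mu]_p (phi (dil 1 p) * npow m (phi p)).
Proof.
move=> m1 hs hm t0; have t0' : t != 0 by rewrite gt_eqF.
have ht := sqint_dil t0' hs; have htm := sqint_dil t0' hm.
have ip := sqint_mul hs hm.
have it := sqint_mul ht htm.
have -> : \int[mu]_p (phi (dil 1 p) * npow m (phi p)) = \int[mu]_p (phi p * npow m (phi p)).
  by apply: eq_Rintegral => p _; rewrite dil1.
have m10 : m + 1 != 0 by rewrite gt_eqF//; lra.
have -> : (m + t `^ (- 2)) / (m + 1) * \int[mu]_p (phi p * npow m (phi p)) =
    \int[mu]_p ((m + 1)^-1 * (m * (phi p * npow m (phi p)) +
      phi (dil t p) * npow m (phi (dil t p)))).
  rewrite RintegralZl//; last exact: (intgD (intgZ m ip) it).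
  rewrite RintegralD//; last exact: (intgZ m ip).
  rewrite RintegralZl//.
  rewrite (Rint_dil (f := fun p => phi p * npow m (phi p)) t0' ip) powR_N2//.
  by field; rewrite m10 gt_eqF.
apply: le_Rintegral => //.
- exact: (sqint_mul ht hm).
- exact: (intgZ _ (intgD (intgZ m ip) it)).
- by move=> p _; rewrite [leRHS]mulrC young_npow.
Qed.

(** The transform of p |-> phi (t p) is xi |-> t ^ - 2 F (xi / t).  Truncating phi
    at the radius k' n truncates its dilation at k' n / t, and k' is chosen so that
    this exceeds n. *)
Lemma parseval_dil phi g F k t : sqint mu phi -> sqint mu g -> continuous phi ->
  is_fourier phi F -> is_fourier g (fun xi => (k xi)%:C%C * F xi) -> 0 < t ->
  \int[mu]_xi (k xi * complex.Re (F xi) * (t ^- 2 * complex.Re (F (dil t^-1 xi))) +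
     k xi * complex.Im (F xi) * (t ^- 2 * complex.Im (F (dil t^-1 xi)))) =
  (2 * pi) ^+ 2 * \int[mu]_p (phi (dil t p) * g p).
Proof.
move=> hs hg cphi /is_fourier_lim fphi /is_fourier_lim fg t0.
have t0' : t != 0 by rewrite gt_eqF.
have [N tN] : exists N : nat, t <= N%:R.
  by exists (Num.bound t); exact: ltW (archi_boundP (ltW t0)).
pose k' n := (n.+1 * N.+1)%N.
have koo : k' n @[n --> \oo] --> \oo.
  move=> A [M _ MA]; exists M => // n /= Mn; apply: MA => /=.
  by rewrite (leq_trans Mn)// (leq_trans (leqnSn n))// leq_pmulr.
have ft := fourier_lim_dil t0 hs (fourier_lim_sub koo fphi).
have ct : continuous (fun p => phi (dil t p)).
  move=> p; have c1 : t * q.1 @[q --> p] --> t * p.1.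
    by apply: cvgM; [exact: cvg_cst|exact: cvg_fst].
  have c2 : t * q.2 @[q --> p] --> t * p.2.
    by apply: cvgM; [exact: cvg_cst|exact: cvg_snd].
  have cd : dil t q @[q --> p] --> dil t p by exact: (cvg_pair c1 c2).
  exact: (cvg_comp _ _ cd (cphi _)).
have rr n : 0 <= (n%:R : R) < (k' n)%:R / t.
  rewrite ler0n/= ltr_pdivlMr// /k' natrM.
  rewrite (@le_lt_trans _ _ (n%:R * N%:R)) ?ler_wpM2l//.
  by rewrite -!natrM ltr_nat ltn_mul.
have := parseval_lim hg (sqint_dil t0' hs) ct fg ft rr (@cvgr_idn R).
under [in X in _ = X -> _]eq_Rintegral do rewrite mulrC.
move=> <-; apply: eq_Rintegral => xi _.
case: (F xi) => a b; case: (F (dil t^-1 xi)) => a' b' /=; ring.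
Qed.

End Bounds.

(** * The Pohozaev relations *)
Section Pohozaev.
Variable R : realType.
Local Notation mu := (leb2 R).
Local Notation plane := (measurableTypeR R * measurableTypeR R)%type.
Implicit Types (phi g u : R * R -> R) (F : R * R -> R[i]) (p q xi : R * R) (t s m : R).

Let energy s F xi := dot2 xi xi `^ s * (complex.Re (F xi) ^+ 2 + complex.Im (F xi) ^+ 2).

Let energy_ge0 s F xi : 0 <= energy s F xi.
Proof. by rewrite mulr_ge0 ?powR_ge0 ?addr_ge0 ?sqr_ge0. Qed.

Let intg_energy s phi g F : is_fourier phi F ->
  is_fourier g (fun xi => (dot2 xi xi `^ s)%:C%C * F xi) -> intg mu (energy s F).
Proof.
move=> [_ /L2_sqint re /L2_sqint im _] [_ /L2_sqint kre /L2_sqint kim _].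
apply: eq_intg (intgD (sqint_mul kre re) (sqint_mul kim im)) => xi.
by rewrite /energy; case: (F xi) => a b /=; ring.
Qed.

Let energyE s phi g F : sqint mu phi -> sqint mu g -> continuous phi ->
  is_fourier phi F -> is_fourier g (fun xi => (dot2 xi xi `^ s)%:C%C * F xi) ->
  \int[mu]_xi energy s F xi = (2 * pi) ^+ 2 * \int[mu]_p (phi (dil 1 p) * g p).
Proof.
move=> hs hg cphi fphi fg; rewrite -(parseval_dil hs hg cphi fphi fg ltr01).
by apply: eq_Rintegral => xi _; rewrite invr1 expr1n invr1 dil1 /energy; ring.
Qed.

Lemma frac_ge0 s phi g F : sqint mu phi -> sqint mu g -> continuous phi ->
  is_fourier phi F -> is_fourier g (fun xi => (dot2 xi xi `^ s)%:C%C * F xi) ->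
  0 <= \int[mu]_p (phi (dil 1 p) * g p).
Proof.
move=> hs hg cphi fphi fg.
have K0 : 0 < (2 * pi) ^+ 2 :> R by rewrite exprn_gt0// mulr_gt0// pi_gt0.
rewrite -(pmulr_rge0 _ K0) -(energyE hs hg cphi fphi fg).
by apply: Rintegral_ge0 => xi _; exact: energy_ge0.
Qed.

(** On the Fourier side the integrand is k (xi) times the real part of F (xi) and
    the conjugate of F (xi / t), with k (xi) = |xi| ^ (2 s).  It is at most half the
    sum of the squared moduli, and k (t xi) = t ^ (2 s) k (xi) scales the second
    one. *)
Lemma frac_bound s phi g F t : sqint mu phi -> sqint mu g -> continuous phi ->
  is_fourier phi F -> is_fourier g (fun xi => (dot2 xi xi `^ s)%:C%C * F xi) -> 0 < t ->
  \int[mu]_p (phi (dil t p) * g p) <=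
  (t `^ (- 2) + t `^ (2 * s)) / 2 * \int[mu]_p (phi (dil 1 p) * g p).
Proof.
move=> hs hg cphi fphi fg t0.
have t0' : t != 0 by rewrite gt_eqF.
have ti0 : t^-1 != 0 by rewrite invr_eq0.
have K0 : 0 < (2 * pi) ^+ 2 :> R by rewrite exprn_gt0// mulr_gt0// pi_gt0.
rewrite -(ler_pM2l K0) mulrCA -(energyE hs hg cphi fphi fg).
rewrite -(parseval_dil hs hg cphi fphi fg t0).
have Ei := intg_energy fphi fg.
have Eti := intg_dil ti0 Ei.
have kdil xi : dot2 xi xi `^ s = t `^ (2 * s) * dot2 (dil t^-1 xi) (dil t^-1 xi) `^ s.
  rewrite powRrM powR_mulrn ?ltW// -powRM ?sqr_ge0//; last first.
    by rewrite addr_ge0// -expr2 sqr_ge0.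
  by congr (_ `^ _); rewrite /dot2 /dil /=; field.
have -> : (t `^ (- 2) + t `^ (2 * s)) / 2 * \int[mu]_xi energy s F xi =
    \int[mu]_xi (t ^- 2 / 2 * (energy s F xi + t `^ (2 * s) * energy s F (dil t^-1 xi))).
  rewrite RintegralZl//; last exact: (intgD Ei (intgZ _ Eti)).
  rewrite RintegralD//; last exact: (intgZ _ Eti).
  rewrite RintegralZl// (Rint_dil ti0 Ei) powR_N2//.
  by field; rewrite t0'.
have [_ /L2_sqint re /L2_sqint im _] := fphi.
have [_ /L2_sqint kre /L2_sqint kim _] := fg.
apply: le_Rintegral => //.
- apply: eq_intg (intgD
    (sqint_mul kre (sqintZ (t ^- 2) (sqint_dil ti0 re)))
    (sqint_mul kim (sqintZ (t ^- 2) (sqint_dil ti0 im)))) => xi /=.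
  by case: (F xi) => a b /=; ring.
- exact: (intgZ _ (intgD Ei (intgZ _ Eti))).
- move=> xi _; rewrite /energy mulrA -kdil.
  set k := _ `^ s; set a := complex.Re _; set b := complex.Im _.
  set a' := complex.Re _; set b' := complex.Im _.
  have kt : 0 <= k * t ^- 2 / 2.
    by rewrite divr_ge0// mulr_ge0 ?powR_ge0// invr_ge0 sqr_ge0.
  have h : 0 <= (a - a') ^+ 2 + (b - b') ^+ 2 by rewrite addr_ge0// sqr_ge0.
  rewrite -subr_ge0.
  rewrite (_ : _ - _ = k * t ^- 2 / 2 * ((a - a') ^+ 2 + (b - b') ^+ 2)); first exact: mulr_ge0.
  by field; rewrite t0'.
Qed.

(** Combines [dil_derivative] and [touching]: a bound on the dilated integrals that
    is sharp at t = 1 determines the integral against the radial derivative. *)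
Lemma virial phi u (U : R -> R) (d : R) : C1 phi -> sqint mu phi ->
  sqint mu (radial phi) -> sqint mu u ->
  (forall t, 0 < t -> \int[mu]_p (phi (dil t p) * u p) <=
     U t * \int[mu]_p (phi (dil 1 p) * u p)) ->
  U 1 = 1 -> is_derive (1 : R) (1 : R) U d ->
  \int[mu]_p (radial phi p * u p) = d * \int[mu]_p (phi p * u p).
Proof.
move=> hphi hs hr hu bound U1 Ud.
have -> : \int[mu]_p (phi p * u p) = \int[mu]_p (phi (dil 1 p) * u p).
  by apply: eq_Rintegral => p _; rewrite dil1.
set A := \int[mu]_p (phi (dil 1 p) * u p).
apply: (@touching R (fun t => \int[mu]_p (phi (dil t p) * u p)) (fun t => U t * A)) => //.
- by rewrite U1 mul1r.
- by apply: is_derive_eq; rewrite /GRing.scale/= mulr0 add0r mulrC.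
- by move=> l hl; exact: dil_derivative.
Qed.

Lemma is_derive_powR1 (r : R) : is_derive (1 : R) (1 : R) (fun t => t `^ r) r.
Proof. by have := is_derive1_powR r ltr01; rewrite powR1 mulr1. Qed.

Lemma pohozaev phi s m c nu1 nu2 : 0 < s -> 1 < m -> nu2 != 0 ->
  smooth_vanishing phi -> (exists p, phi p != 0) -> solves s m c nu1 nu2 phi ->
  exists M A N, [/\ 0 < M, 0 <= A, 0 < N,
    - c * M + nu1 * A + nu2 / m * N = 0 &
    c * M - nu1 * (1 - s) * A - 2 * nu2 / (m * (m + 1)) * N = 0].
Proof.
move=> s0 m1 nu20 [hphi /L2_sqint hs /L2_sqint hX /L2_sqint hY] [p0 p00].
move=> [g [[F [fphi fg]] eqn]].
have cphi := C1_continuous hphi.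
have hr : sqint mu (radial phi) := sqintD hX hY.
have hg : sqint mu g by case: fg => /L2_sqint.
have m0 : m != 0 by rewrite gt_eqF//; lra.
have m10 : m + 1 != 0 by rewrite gt_eqF//; lra.
have mphi : measurable_fun setT (phi : plane -> R) by case: hs.
pose h p := npow m (phi p).
(* The equation expresses h through phi and g. *)
have hh : sqint mu h.
  apply: (@ae_sqint _ _ _ mu _ (fun p => (m / nu2) * (c * phi p + (- nu1) * g p))).
  - exact: measurable_npow.
  - by apply: sqintZ; apply: sqintD; exact: sqintZ.
  - apply: ae_imply eqn => p E; rewrite /h /npow.
    set y := _ * phi p in E *.
    have -> : c * phi p + - nu1 * g p = nu2 / m * y by lra.
    by field; rewrite m0.
have test u : sqint mu u -> - c * \int[mu]_p (u p * phi p) + nu1 * \int[mu]_p (u p * g p) +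
    nu2 / m * \int[mu]_p (u p * h p) = 0.
  move=> hu; have i1 := sqint_mul hu hs; have i2 := sqint_mul hu hg.
  have i3 := sqint_mul hu hh.
  rewrite -!RintegralZl// -RintegralD//; [|exact: intgZ|exact: intgZ].
  rewrite -RintegralD//; [|by apply: intgD; exact: intgZ|exact: intgZ].
  rewrite (@ae_intg _ _ _ mu _ (fun=> 0) _ _ _).2.
  - by rewrite /Rintegral integral0.
  - by apply: (@intg_meas _ _ _ mu); apply: intgD; [apply: intgD; exact: intgZ|exact: intgZ].
  - exact: integrable0.
  - apply: ae_imply eqn => p E; rewrite /h /npow.
    have -> : 0 = u p * 0 :> R by rewrite mulr0.
    by rewrite -E; ring.
(* A nonnegative f that vanishes only where phi does has a positive integral,
   since the continuous function phi is not almost everywhere zero. *)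
have posit (f : R * R -> R) : intg mu f -> (forall p, 0 <= f p) ->
    (forall p, f p = 0 -> phi p = 0) ->
    0 < \int[mu]_p f p.
  move=> fi f0 fphi0; rewrite lt_neqAle eq_sym Rintegral_ge0// andbT.
  apply/eqP => If; have ae0 := Rint_eq0_ae fi f0 If.
  have := continuous_ae0 cphi; have ae1 : {ae mu, forall p, phi p = 0}.
    by apply: ae_imply ae0 => p; exact: fphi0.
  by move=> /(_ ae1 p0); apply/eqP.
exists (\int[mu]_p (phi p * phi p)), (\int[mu]_p (phi p * g p)), (\int[mu]_p (phi p * h p)).
split.
- apply: posit; first exact: sqint_mul.
    by move=> p; rewrite -expr2 sqr_ge0.
  by move=> p /eqP; rewrite mulf_eq0 orbb => /eqP.
- have := frac_ge0 hs hg cphi fphi fg.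
  by under eq_Rintegral do rewrite dil1.
- apply: posit; first exact: sqint_mul.
    by move=> p; rewrite npowE// powR_ge0.
  move=> p; rewrite npowE// => /eqP; rewrite powR_eq0 normr_eq0 => /andP[/eqP-> _] //.
- exact: test.
have D1 : is_derive (1 : R) (1 : R) (fun t => (1 + t `^ (- 2)) / 2) (- 1).
  have d2 := is_derive_powR1 (- 2).
  by apply: is_derive_eq; rewrite /GRing.scale/=; field.
have D2 : is_derive (1 : R) (1 : R) (fun t => (t `^ (- 2) + t `^ (2 * s)) / 2) (s - 1).
  have d2 := is_derive_powR1 (- 2); have d3 := is_derive_powR1 (2 * s).
  by apply: is_derive_eq; rewrite /GRing.scale/=; field.
have D3 : is_derive (1 : R) (1 : R) (fun t => (m + t `^ (- 2)) / (m + 1)) (- 2 / (m + 1)).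
  have d2 := is_derive_powR1 (- 2).
  apply: is_derive_eq; rewrite /GRing.scale/=; field.
  by rewrite m10.
have E1 := virial hphi hs hr hs (fun t => self_bound hs) _ D1.
have E2 := virial hphi hs hr hg (fun t => frac_bound hs hg cphi fphi fg) _ D2.
have E3 := virial hphi hs hr hh (fun t => power_bound m1 hs hh) _ D3.
have := test _ hr.
rewrite E1; last by rewrite powR1; field.
rewrite E2; last by rewrite !powR1; field.
rewrite E3; last by rewrite powR1 divff.
move=> E; rewrite -[RHS]E; field.
by rewrite m0 m10.
Qed.

End Pohozaev.

Theorem proposition2p7 (R : realType) (s m c nu1 nu2 : R)
    (hs0 : 0 < s) (hs1 : s < 1) (hm : 1 < m)
    (hnu1 : nu1 != 0) (hnu2 : nu2 = 1 \/ nu2 = -1) :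
  (exists phi : R * R -> R,
     [/\ smooth_vanishing phi, (exists p, phi p != 0)
       & solves s m c nu1 nu2 phi]) ->
     [/\ nu1 < 0, nu2 = 1, 0 < c & 1 < m < (1 + s) / (1 - s)]
  \/ [/\ 0 < nu1, nu2 = -1, c < 0 & 1 < m < (1 + s) / (1 - s)]
  \/ [/\ 0 < nu1, nu2 = -1, 0 < c & (1 + s) / (1 - s) < m]
  \/ [/\ nu1 < 0, nu2 = 1, c < 0 & (1 + s) / (1 - s) < m]
  \/ [/\ c = 0, nu1 * nu2 < 0 & m = (1 + s) / (1 - s)].
Proof.
move=> [phi [sv nz sol]].
have nu20 : nu2 != 0 by case: hnu2 => ->; rewrite ?oppr_eq0 oner_eq0.
have [M [A [N [M0 A0 N0 e1 e2]]]] := pohozaev hs0 hm nu20 sv nz sol.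
have m0 : 0 < m by lra.
(* This multiple of N clears the denominators of both relations. *)
pose N' := N / (m * (m + 1)).
have N'0 : 0 < N' by rewrite divr_gt0// mulr_gt0//; lra.
have NE : N = m * (m + 1) * N' by rewrite /N'; field; rewrite !gt_eqF//; lra.
(* The sum of the two relations. *)
have r1 : nu1 * s * A = - nu2 * (m - 1) * N'.
  have : nu2 / m * N = nu2 * (m + 1) * N' by rewrite NE; field; rewrite gt_eqF.
  have : 2 * nu2 / (m * (m + 1)) * N = 2 * nu2 * N'.
    by rewrite NE; field; rewrite !gt_eqF//; lra.
  lra.
(* The first relation, with A eliminated by r1. *)
have r2 : s * (c * M) = nu2 * N' * ((1 + s) - m * (1 - s)).
  have : nu2 / m * N = nu2 * (m + 1) * N' by rewrite NE; field; rewrite gt_eqF.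
  move=> h; have : c * M = nu1 * A + nu2 * (m + 1) * N' by lra.
  move=> ->; have -> : s * (nu1 * A + nu2 * (m + 1) * N') =
    nu1 * s * A + s * (nu2 * (m + 1) * N') by ring.
  by rewrite r1; ring.
have s10 : 0 < 1 - s by lra.
have nu1s : nu1 * nu2 < 0.
  have m1N : 0 < (m - 1) * N' by rewrite mulr_gt0// subr_gt0.
  have A1 : nu1 * nu2 * (s * A) < 0.
    have -> : nu1 * nu2 * (s * A) = (nu1 * s * A) * nu2 by ring.
    by rewrite r1; case: hnu2 => ->; lra.
  rewrite ltNge; apply/negP => nn; have := mulr_ge0 nn (mulr_ge0 (ltW hs0) A0); lra.
have cs : c * nu2 * (s * M) = N' * ((1 + s) - m * (1 - s)).
  have -> : c * nu2 * (s * M) = (s * (c * M)) * nu2 by ring.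
  by rewrite r2; case: hnu2 => ->; ring.
have sM : 0 < s * M by rewrite mulr_gt0.
have [lt|gt|E] := ltgtP m ((1 + s) / (1 - s)).
- have : 0 < c * nu2.
    rewrite -(pmulr_lgt0 _ sM) cs mulr_gt0// subr_gt0.
    by rewrite -ltr_pdivlMr.
  by case: hnu2 nu1s => -> nn cn; [left|right; left]; split => //; rewrite ?hm; lra.
- have : c * nu2 < 0.
    rewrite -(pmulr_llt0 _ sM) cs pmulr_rlt0// subr_lt0.
    by rewrite -ltr_pdivrMr.
  by case: hnu2 nu1s => -> nn cn; [do 3 right; left|do 2 right; left]; split => //; lra.
- do 4 right; split => //.
  have : c * nu2 * (s * M) = 0 by rewrite cs E; field; rewrite gt_eqF.
  by move/eqP; rewrite !mulf_eq0 (negbTE nu20) (gt_eqF hs0) (gt_eqF M0) !orbF => /eqP.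
Qed.
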